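(* Let $0\le r<q$, set $p=q-r$, and for $0\le s\le r$ let $k_s=q-s$ and $m_s=r-s$. Assume that the reduced covariance $\mathcal S_{P_s}$ is proportional to the identity on $\mathbb S^{k_s}$ for every $0\le s\le r$ (isotropy), and write $\Delta_{s,r}:=\Delta_{s,r}(P_s)$ for the fixed-stratum limit statistic constructed from a standard Gaussian matrix $Y_{k_s}$ in $\mathbb S^{k_s}$ (its law is then independent of $P_s$). Then: (i) The fixed-stratum limits can be coupled (realised on one probability space, each with its own law) so that $$\Delta_{0,r}\le\Delta_{1,r}\le\cdots\le\Delta_{r,r}\quad\text{almost surely}.$$ (ii) For every $0\le s\le r$ and every $C\in\mathcal K_{m_s}^{k_s}$, there is a coupling of $Y_{k_s}$ with a standard Gaussian $G_p\in\mathbb S^p$ such that $$\Delta_{m_s}^{\mathrm{tr}}(C;Y_{k_s})\le T_p(G_p):=\sum_{j=1}^p\{\lambda_j(G_p)_+\}^2\quad\text{almost surely}.$$ (iii) The variable $T_p(G_p)$ has the rank-$r$ top-stratum law, i.e. the law of $\Delta_{r,r}$. Hence the rank-$r$ critical value controls every fixed stratum and every local null rank transition in the isotropic experiment: if $q_\alpha$ denotes the upper-$\alpha$ critical value of $\Delta_{r,r}$, $\alpha\in(0,1)$, then $\Pr\{\Delta_{s,r}>q_\alpha\}\le\alpha$ and $\Pr\{\Delta_{m_s}^{\mathrm{tr}}(C;Y_{k_s})>q_\alpha\}\le\alpha$ for all $0\le s\le r$ and all $C\in\mathcal K_{m_s}^{k_s}$.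
   Context: $\mathbb S^d$ is the space of real symmetric $d\times d$ matrices with Frobenius norm $\|\cdot\|_F$, $\mathbb S_+^d$ its positive-semidefinite cone, and $\operatorname{dist}_F(X,A)=\inf_{Z\in A}\|X-Z\|_F$. Eigenvalues are ordered $\lambda_1(M)\ge\cdots\ge\lambda_d(M)$ and $x_+=\max(x,0)$. A standard Gaussian matrix in $\mathbb S^d$ has independent $N(0,1)$ coordinates in the Frobenius-orthonormal basis $E_{ii}$, $F_{ij}=(E_{ij}+E_{ji})/\sqrt2$, $i<j$ (so off-diagonal matrix entries have variance $1/2$). For $0\le m\le k$, $\mathcal K_m^k=\{B\in\mathbb S_+^k:\operatorname{rank}(B)\le m\}$. For each $s\le r$, $P_s$ denotes the orthogonal projector of $\mathbb R^q$ onto a $k_s$-dimensional subspace (the kernel of a rank-$s$ positive-semidefinite matrix), and the reduced covariance $\mathcal S_{P_s}$ is a self-adjoint positive-definite operator on $\mathbb S^{k_s}$. The fixed-stratum limit statistic is $$\Delta_{s,r}(P_s)=\operatorname{dist}_F^2\{Y_{k_s},\mathcal S_{P_s}^{-1/2}(\mathcal K_{m_s}^{k_s})\}-\operatorname{dist}_F^2\{Y_{k_s},\mathcal S_{P_s}^{-1/2}(\mathbb S_+^{k_s})\}.$$ For $C\in\mathcal K_m^k$ and $Y\in\mathbb S^k$, $$\Delta_m^{\mathrm{tr}}(C;Y)=\operatorname{dist}_F^2(Y+C,\mathcal K_m^k)-\operatorname{dist}_F^2(Y+C,\mathbb S_+^k).$$ These are the isotropic local null rank-transition statistics. For a distribution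 function $F$, the upper-$\alpha$ critical value is $q_\alpha(F)=\inf\{c:F(c)\ge1-\alpha\}$. *)

(* Defs.v *)
From HB Require Import structures.
From mathcomp Require Import all_boot all_order all_algebra.
From mathcomp Require Import all_classical all_reals all_analysis.

Set Implicit Arguments.
Unset Strict Implicit.
Unset Printing Implicit Defensive.

Import Order.TTheory GRing.Theory Num.Theory.

Local Open Scope classical_set_scope.
Local Open Scope ring_scope.

Definition symmx (R : realType) (k : nat) : set 'M[R]_k := [set A | A^T = A].
Arguments symmx : clear implicits.

Definition frob_dot (R : realType) (k : nat) (A B : 'M[R]_k) : R :=
  \tr (A^T *m B).

Definition frob_norm (R : realType) (k : nat) (A : 'M[R]_k) : R :=
  Num.sqrt (frob_dot A A).

Definition frob_dist (R : realType) (k : nat) (X : 'M[R]_k)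
    (A : set 'M[R]_k) : R :=
  inf [set frob_norm (X - Z) | Z in A].

Definition psd_cone (R : realType) (k : nat) : set 'M[R]_k :=
  [set A | symmx R k A /\ forall x : 'cV[R]_k, 0 <= (x^T *m A *m x) 0 0].
Arguments psd_cone : clear implicits.

Definition rank_cone (R : realType) (m k : nat) : set 'M[R]_k :=
  [set B | psd_cone R k B /\ (\rank B <= m)%N].
Arguments rank_cone : clear implicits.

(* [eigenvalues M] is the non-increasing list of the [k] real eigenvalues of
   [M], counted with multiplicity. It is meant for symmetric [M]; the default
   [nseq k 0] is returned only if the characteristic polynomial does not split
   over [R]. Indices are shifted: lambda_j(M) is [(eigenvalues M)`_j.-1]. *)
Definition eigenvalues (R : realType) (k : nat) (M : 'M[R]_k) : seq R :=
  xget (nseq k 0) [set l : seq R | sorted >=%R l /\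
    char_poly M = \prod_(x <- l) ('X - x%:P)].

Definition orth_projector (R : realType) (q k : nat) (P : 'M[R]_q) : Prop :=
  [/\ P^T = P, P *m P = P & \rank P = k].

(* Operators on the space of symmetric matrices are represented by linear
   endomorphisms of the space of all matrices which preserve symmetry; only
   their values at symmetric matrices are ever used. *)
Definition selfadjoint_pd (R : realType) (k : nat) (S : 'End('M[R]_k)) : Prop :=
  [/\ forall A, symmx R k A -> symmx R k (S A),
      forall A B, symmx R k A -> symmx R k B ->
        frob_dot (S A) B = frob_dot A (S B)
    & forall A, symmx R k A -> A != 0 -> 0 < frob_dot (S A) A].

Definition isotropic (R : realType) (k : nat) (S : 'End('M[R]_k)) : Prop :=
  exists c : R, forall A, symmx R k A -> S A = c *: A.

(* The self-adjoint positive-definite operator whose square is the inverse of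
   [S] on symmetric matrices; it is unique as an operator on that space. *)
Definition inv_sqrt_op (R : realType) (k : nat) (S : 'End('M[R]_k)) :
    'End('M[R]_k) :=
  xget 0 [set V : 'End('M[R]_k) | selfadjoint_pd V /\
    forall A, symmx R k A -> V (V (S A)) = A].

Definition stratum_stat (R : realType) (k m : nat) (S : 'End('M[R]_k))
    (Y : 'M[R]_k) : R :=
  frob_dist Y (inv_sqrt_op S @` rank_cone R m k) ^+ 2
  - frob_dist Y (inv_sqrt_op S @` psd_cone R k) ^+ 2.

Definition transition_stat (R : realType) (k m : nat) (C Y : 'M[R]_k) : R :=
  frob_dist (Y + C) (rank_cone R m k) ^+ 2
  - frob_dist (Y + C) (psd_cone R k) ^+ 2.

Definition pos_eig_stat (R : realType) (p : nat) (G : 'M[R]_p) : R :=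
  \sum_(j < p) (Num.max (eigenvalues G)`_j 0) ^+ 2.

Definition mutually_independent (d : measure_display) (T : measurableType d)
    (R : realType) (P : probability T R) (I : finType)
    (Z : I -> {RV P >-> R}) : Prop :=
  forall (J : {set I}) (B : I -> set R), (forall i, measurable (B i)) ->
    (P (\bigcap_(i in [set` J]) (Z i @^-1` B i)) =
     \prod_(i in J) P (Z i @^-1` B i))%E.

(* The orthonormal basis E_ii, F_ij (i < j) of the symmetric matrices is
   indexed by the pairs i <= j. *)
Definition sym_index (k : nat) := {ij : 'I_k * 'I_k | (ij.1 <= ij.2)%N}.

Definition sym_basis (R : realType) (k : nat) (u : sym_index k) : 'M[R]_k :=
  let: (i, j) := val u in
  if i == j then delta_mx i i
  else (Num.sqrt 2)^-1 *: (delta_mx i j + delta_mx j i).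
Arguments sym_basis : clear implicits.

Definition std_gaussian (d : measure_display) (T : measurableType d)
    (R : realType) (P : probability T R) (k : nat) (Y : T -> 'M[R]_k) : Prop :=
  exists Z : sym_index k -> {RV P >-> R},
    [/\ mutually_independent Z,
        forall u (B : set R), measurable B ->
          distribution P (Z u) B = normal_prob 0 1 B
      & forall w, Y w = \sum_u Z u w *: sym_basis R k u].

Definition same_law (d d' : measure_display) (T : measurableType d)
    (T' : measurableType d') (R : realType) (P : probability T R)
    (P' : probability T' R) (X : T -> R) (X' : T' -> R) : Prop :=
  [/\ measurable_fun setT X, measurable_fun setT X'
    & forall B : set R, measurable B -> pushforward P X B = pushforward P' X' B].

(* The library's [cdf], for a function not bundled as a random variable. *)
Definition distr_fun (d : measure_display) (T : measurableType d)
    (R : realType) (P : probability T R) (X : T -> R) (c : R) : \bar R :=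
  P [set w | X w <= c].

Definition upper_crit (R : realType) (F : R -> \bar R) (alpha : R) : R :=
  inf [set c | ((1 - alpha)%:E <= F c)%E].

(* Main.v *)
Require Import Defs.
From HB Require Import structures.
From mathcomp Require Import all_boot all_order all_algebra.
From mathcomp Require Import perm complex.
From mathcomp Require Import all_classical all_reals all_analysis.
From mathcomp Require Import measurable_realfun.
From mathcomp Require Import ring lra zify.

Set Implicit Arguments.
Unset Strict Implicit.
Unset Printing Implicit Defensive.

Import Order.TTheory GRing.Theory Num.Theory.

Local Open Scope classical_set_scope.
Local Open Scope ring_scope.

(** Under isotropy the covariance only rescales the cones, which are invariant
    under positive scaling, so that the fixed-stratum statistic is the
    rank-transition statistic at [C = 0] ([stratum_stat_isotropic]). Every
    claim thus concerns [transition_stat m C Y] with [Y] Gaussian.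

    The deterministic part is the formula [transition_statE]: the statistic is
    the sum of the squared positive parts of the eigenvalues of [Y + C] of index
    larger than [m]. The squared distance to the matrices of rank at most [m] in
    the cone is computed without any trace inequality: for [B] in this set, the
    Weyl inequalities compare the eigenvalues of [M - B] with those of [M] in
    both directions, which bounds the distance from below, and the spectral
    truncation of [M] attains the bound. Cauchy interlacing then gives
    [transition_stat_compression]: compressing by an isometry [U] to a subspace
    of codimension [c] while lowering [m] by [c] does not decrease the
    statistic. All these eigenvalue inequalities are instances of one
    Courant-Fischer argument ([interlacing]).

    The probabilistic part is that the compression [U^T *m Y *m U] of a standard
    Gaussian matrix is again standard Gaussian ([std_gaussian_compression]). In
    orthonormal coordinates, compression is a matrix with orthonormal rows, so
    this is the invariance of standard Gaussian vectors under such matrices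
    ([gaussian_preserving_isometry]). It is reduced to reflections of the plane,
    where it is a computation with Tonelli's theorem and affine substitutions
    ([normal2_reflection]), by moving a unit row to the first basis vector with
    reflections in coordinate planes and a sign change, and induction on the
    number of rows. The other coordinates are kept apart by carrying an event
    along ([gaussian_on]).

    The couplings are then explicit. For (i), all strata are realized by the
    leading principal submatrices of one Gaussian matrix of size [q]: from [s]
    to [t] both the size and the rank bound drop by [t - s]. For (ii), compress
    to [p] eigenvectors in the kernel of [C]: the matrix [C] disappears and the
    rank bound becomes zero, where the statistic is [pos_eig_stat]. The same
    compression, applied to the given matrix, compares the tail probabilities
    in (iii), as the infimum that defines the critical value is attained
    ([upper_crit_tail]). *)

(** * Real symmetric matrices *)

Lemma row_sqnormE (R : comPzRingType) n (v : 'rV[R]_n) :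
  (v *m v^T) 0 0 = \sum_j v 0 j ^+ 2.
Proof. by rewrite mxE; apply: eq_bigr => j _; rewrite mxE expr2. Qed.

Lemma row_sqnorm_ge0 (R : realDomainType) n (v : 'rV[R]_n) :
  0 <= (v *m v^T) 0 0.
Proof. by rewrite row_sqnormE sumr_ge0// => j _; rewrite sqr_ge0. Qed.

Lemma row_sqnorm_eq0 (R : realDomainType) n (v : 'rV[R]_n) :
  (v *m v^T) 0 0 = 0 -> v = 0.
Proof.
rewrite row_sqnormE => /eqP; rewrite psumr_eq0 => [/allP v0|? _]; last first.
  exact: sqr_ge0.
apply/rowP => j; have := v0 j (mem_index_enum _).
by rewrite sqrf_eq0 mxE => /eqP.
Qed.

Lemma diag_formE (R : comPzRingType) n (v d : 'rV[R]_n) :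
  (v *m diag_mx d *m v^T) 0 0 = \sum_j d 0 j * v 0 j ^+ 2.
Proof.
rewrite mxE; apply: eq_bigr => j _.
by rewrite mul_mx_diag !mxE expr2 mulrAC mulrC.
Qed.

(** Over the algebraically closed field [R[i]] the matrix is hermitian, so the
    entries of its spectral diagonal are real; one of them is a root of the
    characteristic polynomial, which has coefficients in [R]. *)
Lemma symmetric_eigenvalue (R : rcfType) n (A : 'M[R]_n.+1) :
  A^T = A -> exists a, eigenvalue A a.
Proof.
move=> sA; pose AC := map_mx (real_complex R) A.
have hAC : AC \is hermsymmx.
  apply: realsym_hermsym.
    by apply/is_hermitianmxP; rewrite expr0 scale1r map_mx_id// map_trmx sA.
  apply/mxOverP => i j; rewrite mxE; apply/Creal_ImP.
  by rewrite -complexIm.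
have /orthomx_spectralP EA := hermitian_normalmx hAC.
have /mxOverP /(_ ord0 ord0) dR := hermitian_spectral_diag_real hAC.
set d := spectral_diag AC in EA dR; set P := spectralmx AC in EA.
have uP : P \in unitmx by exact: spectral_unit.
have [x dx] : exists x : R, d ord0 ord0 = real_complex R x.
  by exists (complex.Re (d ord0 ord0)); rewrite RRe_real.
exists x; suff: eigenvalue AC (d ord0 ord0).
  by rewrite dx !eigenvalue_root_char -map_char_poly fmorph_root.
apply/eigenvalueP; exists (row ord0 P); last first.
  apply/eqP => P0; move: uP; rewrite -row_free_unit => /row_freeP[B].
  move/(congr1 (row ord0)); rewrite row_mul P0 mul0mx.
  by move/rowP => /(_ ord0) /eqP; rewrite !mxE eqxx eq_sym oner_eq0.
rewrite -row_mul EA !mulmxA mulmxV// mul1mx row_mul.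
by rewrite row_diag_mx -scalemxAl -rowE.
Qed.

(** The Householder reflection in the direction [a - e], with [e] the first
    basis vector, is symmetric and exchanges [a] and [e]. *)
Lemma orthogonal_first_row (R : rcfType) n (a : 'rV[R]_n.+1) :
  a *m a^T = 1%:M ->
  exists H : 'M[R]_n.+1, H *m H^T = 1%:M /\ row ord0 H = a.
Proof.
move=> a1; pose e : 'rV[R]_n.+1 := delta_mx ord0 ord0.
have e1 : e *m e^T = 1%:M.
  by rewrite trmx_delta mul_delta_mx; apply/matrixP=> i j; rewrite !mxE !ord1.
have [ae|ae] := eqVneq a e.
  exists 1%:M; rewrite trmx1 mulmx1; split=> //.
  by rewrite row1 ae.
have [w wE] : exists w, w = a - e by exists (a - e).
pose c := (w *m w^T) 0 0.
have cE : w *m w^T = c%:M by rewrite [LHS]mx11_scalar.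
have c0 : c != 0.
  apply: contra_neq ae => /row_sqnorm_eq0 w0.
  by apply/eqP; rewrite -subr_eq0 -wE w0.
pose H := 1%:M - (2 / c) *: (w^T *m w).
have HT : H^T = H by rewrite /H linearB/= linearZ/= trmx_mul trmxK trmx1.
exists H; split.
  have WW : (w^T *m w) *m (w^T *m w) = c *: (w^T *m w).
    by rewrite -mulmxA (mulmxA w) cE mul_scalar_mx -scalemxAr.
  rewrite HT /H mulmxBl mul1mx -scalemxAl mulmxBr mulmx1 -scalemxAr WW scalerA.
  by apply/matrixP=> i j; rewrite !mxE; field.
have ew : e *m w^T = (- c / 2)%:M.
  have := cE; rewrite wE linearB/= mulmxBl !mulmxBr a1 e1 => E.
  have: a *m e^T = e *m a^T.
    rewrite [LHS]mx11_scalar [RHS]mx11_scalar -[LHS]trmxK tr_scalar_mx.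
    by rewrite -mx11_scalar trmx_mul trmxK -mx11_scalar.
  move=> ae'; rewrite ae' in E; rewrite [LHS]mx11_scalar; congr (_%:M).
  by move/matrixP: E => /(_ 0 0); rewrite !mxE !eqxx !mulr1n; lra.
rewrite rowE -/e /H mulmxBr mulmx1 -scalemxAr mulmxA ew mul_scalar_mx scalerA.
rewrite (_ : _ / c * _ = -1); last by field.
by rewrite scaleN1r opprK wE addrC subrK.
Qed.

(** A unit eigenvector is completed to an orthogonal matrix; conjugation by it
    splits off a block of size one, and the rest is diagonalized by
    induction. *)
Theorem spectral_theorem (R : rcfType) n (A : 'M[R]_n) : A^T = A ->
  exists (Q : 'M[R]_n) (d : 'rV[R]_n),
    Q *m Q^T = 1%:M /\ A = Q^T *m diag_mx d *m Q.
Proof.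
elim: n A => [|n IH] A sA.
  by exists 1%:M, 0; split; apply/matrixP => -[].
have [a /eigenvalueP[v vA v0]] := symmetric_eigenvalue sA.
pose c := (v *m v^T) 0 0.
have cE : v *m v^T = c%:M by rewrite [LHS]mx11_scalar.
have c0 : 0 < c.
  rewrite lt_def row_sqnorm_ge0 andbT.
  by apply: contra_neq v0 => /row_sqnorm_eq0.
pose u := (Num.sqrt c)^-1 *: v.
have uA : u *m A = a *: u by rewrite -scalemxAl vA !scalerA mulrC.
have u1 : u *m u^T = 1%:M.
  rewrite /u linearZ/= -scalemxAl -scalemxAr scalerA cE scale_scalar_mx.
  by rewrite -invfM -expr2 sqr_sqrtr ?ltW// mulVf// gt_eqF.
have [H [H1 H0]] := orthogonal_first_row u1.
have H1' : H^T *m H = 1%:M by rewrite (mulmx1C H1).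
pose B : 'M[R]_(1 + n) := H *m A *m H^T.
have sB : B^T = B by rewrite /B !trmx_mul trmxK sA mulmxA.
have B0 : row ord0 B = a *: delta_mx 0 0.
  rewrite /B row_mul row_mul H0 uA -scalemxAl -H0 -row_mul H1 row1.
  by [].
have BE : B = block_mx a%:M 0 0 (drsubmx B).
  have ur : usubmx B = row_mx a%:M 0.
    apply/rowP=> j; have := congr1 (fun x : 'rV_n.+1 => x 0 j) B0.
    rewrite !mxE (_ : lshift n 0 = ord0); last exact: val_inj.
    move=> ->; case: splitP => k; rewrite ?mxE => jk.
      rewrite -(_ : 0 = j) ?ord1 ?eqxx ?mulr1//; apply/val_inj.
      by rewrite /= jk ord1.
    rewrite eqxx /= (_ : j == 0 = false) ?mulr0//.
    by apply/eqP => j0; rewrite j0 in jk.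
  have ulr : ulsubmx B = a%:M by rewrite /ulsubmx ur row_mxKl.
  have urr : ursubmx B = 0 by rewrite /ursubmx ur row_mxKr.
  rewrite -{1}(submxK B) ulr urr; congr (block_mx _ _ _ _).
  by rewrite -{1}sB -trmx_ursub urr trmx0.
have sD : (drsubmx B)^T = drsubmx B by rewrite trmx_drsub sB.
have [Q [d [Q1 DE]]] := IH _ sD.
pose K : 'M[R]_(1 + n) := block_mx 1%:M 0 0 Q.
have KT : K^T = block_mx 1%:M 0 0 Q^T by rewrite /K tr_block_mx !trmx0 trmx1.
have KK : K *m K^T = 1%:M.
  rewrite KT /K mulmx_block !mulmx0 !mul0mx !mulmx1 !addr0 !add0r Q1.
  by rewrite -scalar_mx_block.
have BK : B = K^T *m diag_mx (row_mx a%:M d) *m K.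
  rewrite BE DE KT /K diag_mx_row !mulmx_block.
  rewrite !mulmx0 !mul0mx !mulmx1 !mul1mx !addr0 !add0r; congr block_mx.
  - by apply/matrixP => i j; rewrite !ord1 !mxE eqxx.
  - by rewrite mul0mx.
exists (K *m H), (row_mx a%:M d); split.
  by rewrite trmx_mul mulmxA -(mulmxA K) H1 mulmx1 KK.
transitivity (H^T *m B *m H).
  by rewrite /B !mulmxA H1' mul1mx -mulmxA H1' mulmx1.
by rewrite BK trmx_mul !mulmxA.
Qed.

(** * Spectra, interlacing and distances to the rank cones *)

(** The list of eigenvalues is extended to a function on all of [nat], so that
    shifted indices such as [j + m] need no bookkeeping; values beyond [k] are
    left free. *)
Definition spectrum (R : rcfType) k (M : 'M[R]_k) (l : nat -> R) : Prop :=
  (forall i j, (i <= j < k)%N -> l j <= l i) /\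
  exists2 Q : 'M[R]_k, Q *m Q^T = 1%:M &
    M = Q^T *m diag_mx (\row_(i < k) l i) *m Q.

(** The Courant-Fischer argument, in a form that covers the Weyl and the Cauchy
    inequalities at once: [A] and [B] embed a common space isometrically into
    the spaces of [M] and [N], and the image of [A] has codimension at most
    [m]. Counting dimensions gives a nonzero [x] such that [x *m A] lies in the
    span of the top [i + m + 1] eigenvectors of [M] and [x *m B] in the span of
    the eigenvectors of [N] from the index [i] on; the two quadratic forms
    at [x] separate the eigenvalues. *)
Lemma interlacing (R : rcfType) k n w m i (M : 'M[R]_k) (N : 'M[R]_n) l l'
    (A : 'M[R]_(w, k)) (B : 'M[R]_(w, n)) :
  spectrum M l -> spectrum N l' ->
  A *m A^T = B *m B^T -> row_free A -> (k <= w + m)%N ->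
  (forall x : 'rV_w, (x *m A *m M *m (x *m A)^T) 0 0 <=
                     (x *m B *m N *m (x *m B)^T) 0 0) ->
  (i + m < k)%N -> (i < n)%N -> l (i + m)%N <= l' i.
Proof.
move=> [ldec [Q Q1 ->]] [l'dec [Q' Q'1 ->]] AB fA kwm ABform imk i_n.
have e1 : ((i + m).+1 + (k - (i + m).+1))%N = k by rewrite subnKC.
have e2 : (i + (n - i))%N = n by rewrite subnKC // ltnW.
pose f j : 'I_k := cast_ord e1 (rshift _ j).
pose g j : 'I_n := cast_ord e2 (lshift _ j).
(* the linear conditions on x: too few of them to exclude a nonzero solution *)
pose C := row_mx (colsub f (A *m Q^T)) (colsub g (B *m Q'^T)).
have kC : kermx C != 0.
  rewrite kermx_eq0 -row_leq_rank -ltnNge.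
  by apply: leq_ltn_trans (rank_leq_col _) _; lia.
have [x xC x0] : exists2 x : 'rV_w, x *m C = 0 & x != 0.
  by move/rowV0Pn: kC => [x /sub_kermxP xC x0]; exists x.
pose y := x *m A *m Q^T; pose z := x *m B *m Q'^T.
have : row_mx (colsub f y) (colsub g z) = 0.
  rewrite -xC mul_mx_row; congr row_mx; apply/rowP => j.
    by rewrite /y -mulmxA !mxE; apply: eq_bigr => t _; rewrite !mxE.
  by rewrite /z -mulmxA !mxE; apply: eq_bigr => t _; rewrite !mxE.
rewrite -[in RHS]row_mx0 => /eq_row_mx [yf zg].
have y0 (j : 'I_k) : (i + m < j)%N -> y 0 j = 0.
  move=> jk; have lj : (j - (i + m).+1 < k - (i + m).+1)%N.
    by have := ltn_ord j; lia.
  move/rowP: yf => /(_ (Ordinal lj)); rewrite !mxE => E.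
  rewrite -[RHS]E; apply: eq_bigr => t _; congr (_ * Q^T t _).
  by apply: val_inj; rewrite /= subnKC.
have z0 (j : 'I_n) : (j < i)%N -> z 0 j = 0.
  move=> ji; move/rowP: zg => /(_ (Ordinal ji)); rewrite !mxE => E.
  rewrite -[RHS]E; apply: eq_bigr => t _; congr (_ * Q'^T t _).
  exact: val_inj.
have Q1' := mulmx1C Q1; have Q'1' := mulmx1C Q'1.
have yy : (y *m y^T) 0 0 = (x *m A *m (x *m A)^T) 0 0.
  by rewrite /y trmx_mul trmxK mulmxA -(mulmxA _ _ Q) Q1' mulmx1.
have zz : (z *m z^T) 0 0 = (x *m A *m (x *m A)^T) 0 0.
  rewrite /z trmx_mul trmxK mulmxA -(mulmxA _ _ Q') Q'1' mulmx1.
  by rewrite !trmx_mul !mulmxA -!(mulmxA x) AB.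
have yy0 : 0 < (y *m y^T) 0 0.
  rewrite lt_def row_sqnorm_ge0 andbT yy.
  apply: contra_neq x0 => /row_sqnorm_eq0 xA0.
  by move/row_freeP: fA => [D AD]; rewrite -[x]mulmx1 -AD mulmxA xA0 mul0mx.
rewrite -(ler_pM2r yy0) {2}yy -zz !row_sqnormE !mulr_sumr.
have := ABform x.
rewrite [X in X <= _ -> _](_ : _ =
    (y *m diag_mx (\row_(i < k) l i) *m y^T) 0 0);
  last by rewrite /y !trmx_mul !trmxK !mulmxA.
rewrite [X in _ <= X -> _](_ : _ =
    (z *m diag_mx (\row_(i < n) l' i) *m z^T) 0 0);
  last by rewrite /z !trmx_mul !trmxK !mulmxA.
rewrite !diag_formE => lyz.
apply: (le_trans _ (le_trans lyz _)); apply: ler_sum => j _;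
  rewrite [(\row_(_ < _) _) 0 j]mxE.
  have [jim|/y0 ->] := leqP j (i + m); last by rewrite expr0n !mulr0.
  by apply: ler_wpM2r; [exact: sqr_ge0|apply: ldec; rewrite jim].
have [ij|/z0 ->] := leqP i j; last by rewrite expr0n !mulr0.
by apply: ler_wpM2r; [exact: sqr_ge0|apply: l'dec; rewrite ij/=].
Qed.

Lemma trace_sqnorm_spectrum (R : rcfType) k (Q : 'M[R]_k) (d : 'rV_k) :
  Q *m Q^T = 1%:M ->
  \tr ((Q^T *m diag_mx d *m Q)^T *m (Q^T *m diag_mx d *m Q)) =
  \sum_j d 0 j ^+ 2.
Proof.
move=> Q1; rewrite !trmx_mul trmxK tr_diag_mx !mulmxA -(mulmxA _ Q) Q1 mulmx1.
rewrite mxtrace_mulC !mulmxA Q1 mul1mx.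
by apply: eq_bigr => j _; rewrite mul_diag_mx !mxE eqxx mulr1n expr2.
Qed.

(** Subtracting [B >= 0] lowers all eigenvalues, but as the form is unchanged
    on the kernel of [B], by at most [m] places. *)
Lemma weyl_psd_rank (R : rcfType) k m (M B : 'M[R]_k) l nu :
  (forall x : 'cV[R]_k, 0 <= (x^T *m B *m x) 0 0) -> (\rank B <= m)%N ->
  spectrum M l -> spectrum (M - B) nu ->
  (forall j, (j < k)%N -> nu j <= l j) /\
  (forall j, (j + m < k)%N -> l (j + m)%N <= nu j).
Proof.
move=> B0 Bm sM sN; split=> j jk.
  rewrite -[j in nu j]addn0.
  apply: (@interlacing _ k k k 0 j (M - B) M nu l 1%:M 1%:M) => //;
    rewrite ?addn0//.
  - by rewrite row_free_unit unitmx1.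
  - move=> x; rewrite !mulmx1 mulmxBr mulmxBl !mxE gerBl.
    by have := B0 x^T; rewrite trmxK mxE.
apply: (@interlacing _ k k (\rank (kermx B)) m j M (M - B) l nu
   (row_base (kermx B)) (row_base (kermx B))) => //.
- exact: row_base_free.
- by rewrite mxrank_ker; lia.
- move=> x; rewrite mulmxBr.
  rewrite (_ : x *m row_base (kermx B) *m B = 0) ?subr0//.
  apply/sub_kermxP; rewrite (submx_trans (submxMl _ _))// eq_row_base.
  exact: submx_refl.
- by lia.
Qed.

Lemma spectrum_of_sorted (R : rcfType) k (M Q : 'M[R]_k) (d : 'rV[R]_k)
    (s : seq R) :
  Q *m Q^T = 1%:M -> M = Q^T *m diag_mx d *m Q ->
  perm_eq s [seq d 0 i | i <- enum 'I_k] -> sorted >=%R s ->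
  spectrum M (nth 0 s).
Proof.
move=> Q1 -> ps so.
have sz : size s = k by rewrite (perm_size ps) size_map size_enum_ord.
split.
  have ge_trans : transitive (>=%R : rel R).
    by move=> x y z yx zy; exact: le_trans yx.
  move=> i j /andP[ij jk].
  apply: (sorted_leq_nth ge_trans (@lexx _ R) 0 so) => //.
    by rewrite inE sz (leq_ltn_trans ij).
  by rewrite inE sz.
have /tuple_permP[p pE] : perm_eq s (mktuple (d 0)) by [].
exists (row_perm p Q).
  rewrite row_permE trmx_mul mulmxA -(mulmxA _ Q) Q1 mulmx1 tr_perm_mx.
  by rewrite -perm_mxM mulgV perm_mx1.
apply/matrixP => a b; rewrite !mxE (reindex_perm p)/=.
apply: eq_bigr => t _; rewrite !mul_mx_diag !mxE; congr (_ * _ * _).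
by rewrite pE (nth_map t) ?size_enum_ord// nth_ord_enum tnth_mktuple.
Qed.

(** The squared distance from a matrix with spectrum [l] to the matrices of
    rank at most [m] in the positive semidefinite cone. *)
Definition truncated_sqsum (R : rcfType) k m (l : nat -> R) : R :=
  \sum_(0 <= j < k) Num.min (l j) 0 ^+ 2 +
  \sum_(m <= j < k) Num.max (l j) 0 ^+ 2.

Lemma sqr_min_max (R : realDomainType) (x : R) :
  x ^+ 2 = Num.min x 0 ^+ 2 + Num.max x 0 ^+ 2.
Proof.
by case: (ltrP x 0) => _; rewrite ?expr0n ?addr0 ?add0r.
Qed.

(** By Weyl, the spectrum [nu] of [M - B] satisfies [nu j <= l j] and
    [l (j + m) <= nu j]; the first bounds the negative parts of the [nu j]
    from below in absolute value, the second their positive parts. *)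
Lemma psd_rank_dist_lower (R : rcfType) k m (M B : 'M[R]_k) l nu :
  (forall x : 'cV[R]_k, 0 <= (x^T *m B *m x) 0 0) -> (\rank B <= m)%N ->
  spectrum M l -> spectrum (M - B) nu ->
  truncated_sqsum k m l <= \tr ((M - B)^T *m (M - B)).
Proof.
move=> B0 Bm sM sN; have [nul lnu] := weyl_psd_rank B0 Bm sM sN.
have [_ [Q Q1 ->]] := sN; rewrite trace_sqnorm_spectrum//.
under eq_bigr do rewrite mxE sqr_min_max.
rewrite big_split/= /truncated_sqsum big_mkord lerD//.
  apply: ler_sum => j _.
  have := nul _ (ltn_ord j); move: (l j) (nu j) => a b ba.
  by case: (ltrP a 0) => a0; case: (ltrP b 0) => b0; nra.
rewrite -{1}[m]add0n big_addn.
apply: (@le_trans _ _ (\sum_(0 <= j < k - m) Num.max (nu j) 0 ^+ 2)).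
  rewrite !big_mkord; apply: ler_sum => j _.
  have jmk : (j + m < k)%N by have := ltn_ord j; lia.
  have := lnu j jmk.
  move: (l _) (nu j) => a b ba.
  by case: (ltrP a 0) => a0; case: (ltrP b 0) => b0; nra.
rewrite [X in _ <= X](_ : _ = \sum_(0 <= j < k) Num.max (nu j) 0 ^+ 2);
  last by rewrite big_mkord.
rewrite (@big_cat_nat _ _ _ (k - m) 0 k) ?leq_subr//= lerDl.
by rewrite sumr_ge0// => j _; rewrite sqr_ge0.
Qed.

(** The lower bound is attained by keeping the positive parts of the [m] largest
    eigenvalues. *)
Lemma psd_truncation (R : rcfType) k m (M : 'M[R]_k) l : spectrum M l ->
  exists B : 'M[R]_k,
    [/\ B^T = B, forall x : 'cV[R]_k, 0 <= (x^T *m B *m x) 0 0,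
       (\rank B <= m)%N &
       \tr ((M - B)^T *m (M - B)) = truncated_sqsum k m l].
Proof.
move=> [ldec [Q Q1 ->]].
pose d : 'rV[R]_k := \row_(j < k) if (j < m)%N then Num.max (l j) 0 else 0.
exists (Q^T *m diag_mx d *m Q); split.
- by rewrite !trmx_mul trmxK tr_diag_mx mulmxA.
- move=> x; have := diag_formE (x^T *m Q^T) d.
  rewrite trmx_mul !trmxK !mulmxA => ->.
  apply: sumr_ge0 => j _; rewrite mulr_ge0 ?sqr_ge0// mxE.
  by case: ifP => // _; rewrite le_max lexx orbT.
- have -> : diag_mx d = diag_mx d *m pid_mx m.
    apply/matrixP => i j; rewrite mul_diag_mx !mxE -val_eqE.
    by case: eqP => [->|_]; case: ifP => _;
      rewrite ?mulr0n ?mulr0 ?mulr1n ?mulr1.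
  rewrite (leq_trans (mxrankM_maxl _ _))// mulmxA.
  rewrite (leq_trans (mxrankM_maxr _ _))//.
  have [mk|/ltnW km] := leqP m k; first by rewrite rank_pid_mx.
  exact: leq_trans (rank_leq_row _) km.
- rewrite -mulmxBl -mulmxBr -linearB trace_sqnorm_spectrum//.
  rewrite /truncated_sqsum [X in _ = _ + X]big_geq_mkord big_mkord.
  rewrite [X in _ = _ + X]big_mkcond -big_split/=; apply: eq_bigr => j _.
  rewrite !mxE; case: ltnP => jm.
    case: (ltrP (l j) 0) => _; rewrite ?subr0 ?addr0// subrr.
    by rewrite expr0n.
  by rewrite subr0 sqr_min_max.
Qed.

(** Cauchy interlacing: passing to a subspace of codimension [k - n] shifts the
    eigenvalues by at most [k - n] places. *)
Lemma compression_sqsum_le (R : rcfType) k n m (M : 'M[R]_k) (U : 'M[R]_(k, n))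
    l l' :
  U^T *m U = 1%:M -> spectrum M l -> spectrum (U^T *m M *m U) l' ->
  \sum_(m + (k - n) <= j < k) Num.max (l j) 0 ^+ 2 <=
  \sum_(m <= j < n) Num.max (l' j) 0 ^+ 2.
Proof.
move=> U1 sM sN.
have fU : row_free U^T by apply/row_freeP; exists U.
have nk : (n <= k)%N by move/eqP: fU => <-; exact: rank_leq_col.
rewrite big_addn subKn// !big_seq; apply: ler_sum => j.
rewrite mem_index_iota => /andP[mj jn].
have : l (j + (k - n))%N <= l' j.
  apply: (interlacing (A := U^T) (B := 1%:M) sM sN) => //.
  - by rewrite trmxK trmx1 mulmx1 U1.
  - by lia.
  - by move=> x; rewrite !mulmx1 trmx_mul trmxK !mulmxA.
  - by lia.
move: (l _) (l' j) => a b ba.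
by case: (ltrP a 0) => a0; case: (ltrP b 0) => b0; nra.
Qed.

Lemma char_poly_orthogonal_conj (R : comNzRingType) k (Q D : 'M[R]_k) :
  Q *m Q^T = 1%:M -> char_poly (Q^T *m D *m Q) = char_poly D.
Proof.
move=> Q1; have Q1' := mulmx1C Q1.
rewrite /char_poly; pose p := map_mx (@polyC R).
have -> : char_poly_mx (Q^T *m D *m Q) = p k k Q^T *m char_poly_mx D *m p k k Q.
  rewrite /char_poly_mx mulmxBr mulmxBl -!map_mxM; congr (_ - _).
  rewrite mul_mx_scalar -scalemxAl -map_mxM Q1' map_mx1.
  by rewrite scalemx1.
rewrite !det_mulmx mulrAC -det_mulmx -map_mxM Q1' map_mx1 det1.
by rewrite mul1r.
Qed.

(** The characteristic polynomial of a symmetric matrix splits, so [eigenvalues]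
    does not return its default, and unique factorization identifies the list
    with the diagonal of the spectral theorem up to order. *)
Lemma spectrum_eigenvalues (R : realType) k (M : 'M[R]_k) : M^T = M ->
  spectrum M (nth 0 (eigenvalues M)).
Proof.
move=> sM; have [Q [d [Q1 ME]]] := spectral_theorem sM.
have cM : char_poly M = \prod_(x <- [seq d 0 i | i <- enum 'I_k]) ('X - x%:P).
  rewrite ME char_poly_orthogonal_conj// char_poly_trig ?diag_mx_is_trig//.
  rewrite big_map big_enum; apply: eq_bigr => i _.
  by rewrite !mxE eqxx mulr1n.
have [eS eM] : sorted >=%R (eigenvalues M) /\
    char_poly M = \prod_(x <- eigenvalues M) ('X - x%:P).
  pose spec := [set l : seq R | sorted >=%R l /\
    char_poly M = \prod_(x <- l) ('X - x%:P)].
  suff : exists l, spec l by move=> /(xgetPex (nseq k 0)).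
  exists (sort >=%R [seq d 0 i | i <- enum 'I_k]); split.
    by apply: sort_sorted => x y; exact: le_total.
  by rewrite cM; apply/esym/perm_big; rewrite perm_sort.
apply: (spectrum_of_sorted Q1 ME) => //.
by apply: prod_XsubC_eq; rewrite -eM -cM.
Qed.

Lemma rank_coneT (R : realType) k : rank_cone R k k = psd_cone R k.
Proof.
by apply/seteqP; split=> [B []//|B ?]; split=> //; exact: rank_leq_row.
Qed.

Lemma frob_dist_rank_cone (R : realType) k m (M : 'M[R]_k) l :
  spectrum M l ->
  frob_dist M (rank_cone R m k) ^+ 2 = truncated_sqsum k m l.
Proof.
move=> sM; have Msym : M^T = M.
  by have [_ [Q _ ->]] := sM; rewrite !trmx_mul trmxK tr_diag_mx mulmxA.
have [B [Bsym B0 Bm BE]] := psd_truncation m sM.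
have tr0 : 0 <= truncated_sqsum k m l.
  by rewrite addr_ge0// sumr_ge0// => j _; rewrite sqr_ge0.
suff -> : frob_dist M (rank_cone R m k) = Num.sqrt (truncated_sqsum k m l).
  by rewrite sqr_sqrtr.
have lb : lbound [set frob_norm (M - Z) | Z in rank_cone R m k]
    (Num.sqrt (truncated_sqsum k m l)).
  move=> _ [Z [[Zsym Z0] Zm] <-]; rewrite /frob_norm ler_wsqrtr//.
  have NS : (M - Z)^T = M - Z by rewrite linearB/= Msym Zsym.
  have := spectrum_eigenvalues NS => sN.
  exact: psd_rank_dist_lower Z0 Zm sM sN.
have inB : [set frob_norm (M - Z) | Z in rank_cone R m k]
    (Num.sqrt (truncated_sqsum k m l)).
  by exists B; [split|rewrite /frob_norm /frob_dot BE].
apply/eqP; rewrite eq_le; apply/andP; split.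
  by apply: ge_inf => //; exists (Num.sqrt (truncated_sqsum k m l)).
by apply: lb_le_inf => //; exists (Num.sqrt (truncated_sqsum k m l)).
Qed.

(** The two squared distances share the contribution of the negative
    eigenvalues; their difference is what the rank constraint cuts off. *)
Lemma transition_statE (R : realType) k m (C Y : 'M[R]_k) l :
  spectrum (Y + C) l ->
  transition_stat m C Y = \sum_(m <= j < k) Num.max (l j) 0 ^+ 2.
Proof.
move=> sM; rewrite /transition_stat -rank_coneT !(frob_dist_rank_cone _ sM).
rewrite /truncated_sqsum [\sum_(k <= j < k) _]big_geq//.
by rewrite addr0 addrC addKr.
Qed.

(** The deterministic heart of all the comparisons: compressing to a subspace
    and lowering the rank by the codimension can only increase the
    statistic. *)
Lemma transition_stat_compression (R : realType) k n m (C Y : 'M[R]_k)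
    (U : 'M[R]_(k, n)) :
  U^T *m U = 1%:M -> Y^T = Y -> C^T = C ->
  transition_stat (m + (k - n)) C Y <=
  transition_stat m (U^T *m C *m U) (U^T *m Y *m U).
Proof.
move=> U1 sY sC.
have sM : (Y + C)^T = Y + C by rewrite linearD/= sY sC.
have sN : (U^T *m (Y + C) *m U)^T = U^T *m (Y + C) *m U.
  by rewrite !trmx_mul trmxK sM mulmxA.
rewrite (transition_statE _ (spectrum_eigenvalues sM)).
rewrite (@transition_statE _ _ _ _ _
  (nth 0 (eigenvalues (U^T *m (Y + C) *m U)))); last first.
  by rewrite -mulmxDl -mulmxDr; exact: spectrum_eigenvalues.
exact: compression_sqsum_le U1 (spectrum_eigenvalues sM)
  (spectrum_eigenvalues sN).
Qed.

Lemma pos_eig_statE (R : realType) p (G : 'M[R]_p) : G^T = G ->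
  pos_eig_stat G = transition_stat 0 0 G.
Proof.
move=> sG.
rewrite (@transition_statE _ _ _ _ _ (nth 0 (eigenvalues G))); last first.
  by rewrite addr0; exact: spectrum_eigenvalues.
by rewrite big_mkord.
Qed.

(** The columns of [U] are eigenvectors for the eigenvalues of index at least
    [m]. These are at most zero by Weyl's inequality against the zero matrix
    [C - C], and at least zero because [C] is positive semidefinite. *)
Lemma kernel_frame (R : realType) k m p (C : 'M[R]_k) :
  rank_cone R m k C -> (m + p = k)%N ->
  exists U : 'M[R]_(k, p), U^T *m U = 1%:M /\ U^T *m C *m U = 0.
Proof.
move=> [[sC C0] Cm] mpk.
have sl := spectrum_eigenvalues sC; set l := nth 0 _ in sl.
have s0 : spectrum (C - C) (fun=> 0).
  split=> //; exists 1%:M; rewrite ?trmx1 ?mulmx1// mul1mx subrr.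
  by apply/matrixP => i j; rewrite !mxE mul0rn.
have [_ l_le0] := weyl_psd_rank C0 Cm sl s0.
have [_ [Q Q1 CE]] := sl.
pose f j : 'I_k := cast_ord mpk (rshift m j).
have f_inj : injective f.
  by move=> a b /cast_ord_inj/rshift_inj.
pose S : 'M[R]_(k, p) := \matrix_(i, j) (i == f j)%:R.
have SDS d : S^T *m diag_mx d *m S = diag_mx (\row_j d 0 (f j)).
  apply/matrixP => a b; rewrite mxE (bigD1 (f a))//= big1 => [|t ta].
    by rewrite mul_mx_diag !mxE eqxx mul1r addr0 (inj_eq f_inj) mulr_natr.
  by rewrite mul_mx_diag !mxE (negbTE ta) !mul0r.
have S1 : S^T *m S = 1%:M.
  rewrite -[S^T]mulmx1 -diag_const_mx SDS.
  by apply/matrixP => a b; rewrite !mxE.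
pose U := Q^T *m S.
have U1 : U^T *m U = 1%:M.
  by rewrite /U trmx_mul trmxK mulmxA -(mulmxA _ Q) Q1 mulmx1.
have UCU : U^T *m C *m U = diag_mx (\row_(j < p) l (m + j)%N).
  rewrite CE /U trmx_mul trmxK !mulmxA -(mulmxA _ Q) Q1 mulmx1.
  rewrite -(mulmxA _ Q) Q1 mulmx1 SDS.
  by apply/matrixP => a b; rewrite !mxE.
exists U; split=> //; rewrite UCU; apply/matrixP => a b; rewrite !mxE.
suff -> : l (m + a)%N = 0 by rewrite mul0rn.
apply/eqP; rewrite eq_le; apply/andP; split.
  by rewrite addnC; apply: l_le0; have := ltn_ord a; lia.
have := C0 (col a U).
have -> : ((col a U)^T *m C *m col a U) 0 0 =
    ((delta_mx a 0)^T *m (U^T *m C *m U) *m delta_mx a 0 : 'M[R]_1) 0 0.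
  by rewrite colE trmx_mul !mulmxA.
by rewrite UCU trmx_delta -rowE -colE !mxE eqxx mulr1n.
Qed.

(** * The isotropic stratum statistic *)

Lemma frob_dotE (R : realType) k (A B : 'M[R]_k) :
  frob_dot A B = \sum_i \sum_j A i j * B i j.
Proof.
rewrite /frob_dot /mxtrace exchange_big; apply: eq_bigr => i _.
by rewrite mxE; apply: eq_bigr => j _; rewrite mxE.
Qed.

Lemma frob_dotC (R : realType) k (A B : 'M[R]_k) : frob_dot A B = frob_dot B A.
Proof.
rewrite !frob_dotE; apply: eq_bigr => i _; apply: eq_bigr => j _.
by rewrite mulrC.
Qed.

Lemma frob_dotDl (R : realType) k (A B C : 'M[R]_k) :
  frob_dot (A + B) C = frob_dot A C + frob_dot B C.
Proof. by rewrite /frob_dot linearD/= mulmxDl linearD. Qed.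

Lemma frob_dotZl (R : realType) k a (A B : 'M[R]_k) :
  frob_dot (a *: A) B = a * frob_dot A B.
Proof. by rewrite /frob_dot linearZ/= -scalemxAl linearZ. Qed.

Lemma frob_dot_ge0 (R : realType) k (A : 'M[R]_k) : 0 <= frob_dot A A.
Proof.
by rewrite frob_dotE; do 2!(apply: sumr_ge0 => ? _); rewrite -expr2 sqr_ge0.
Qed.

Lemma frob_dot_gt0 (R : realType) k (A : 'M[R]_k) : A != 0 -> 0 < frob_dot A A.
Proof.
move=> A0; rewrite lt_def frob_dot_ge0 andbT; apply: contra_neq A0.
rewrite frob_dotE => /eqP; rewrite psumr_eq0 => [/allP A0|i _]; last first.
  by apply: sumr_ge0 => j _; rewrite -expr2 sqr_ge0.
apply/matrixP => i j; have /eqP := A0 i (mem_index_enum _).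
move/eqP; rewrite psumr_eq0 => [/allP /(_ j (mem_index_enum _))|? _].
  by rewrite -expr2 sqrf_eq0 mxE => /eqP.
by rewrite -expr2 sqr_ge0.
Qed.

(** If [S] is [c] times the identity, then [t], the inverse square root of [c],
    gives one admissible operator [t *: \1]. Any other one [V] satisfies
    [(V + t) ((V - t) A) = 0], and [V + t] is injective since [V] is positive
    definite. *)
Lemma inv_sqrt_op_isotropic (R : realType) k (S : 'End('M[R]_k)) :
  (0 < k)%N -> selfadjoint_pd S -> isotropic S ->
  exists2 t : R, 0 < t & forall A, symmx R k A -> inv_sqrt_op S A = t *: A.
Proof.
move=> k0 [_ _ Spd] [c Sc].
have c0 : 0 < c.
  have I0 : (1%:M : 'M[R]_k) != 0.
    apply/eqP => /matrixP /(_ (Ordinal k0) (Ordinal k0)).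
    by rewrite !mxE eqxx => /eqP; rewrite oner_eq0.
  have sI : symmx R k 1%:M by rewrite /symmx/= trmx1.
  have := Spd _ sI I0; rewrite Sc// frob_dotZl pmulr_lgt0//.
  exact: frob_dot_gt0.
pose t := (Num.sqrt c)^-1.
have t0 : 0 < t by rewrite invr_gt0 sqrtr_gt0.
have tt : t * t = c^-1 by rewrite -invfM -expr2 sqr_sqrtr ?ltW.
exists t => // A sA.
pose good := [set V : 'End('M[R]_k) | selfadjoint_pd V /\
    forall A, symmx R k A -> V (V (S A)) = A].
have [[Vsym Vsa Vpd] VVS] : good (inv_sqrt_op S).
  apply: xgetPex; exists (t *: \1%VF)%VF; split; last first.
    move=> B sB; rewrite !lfunE/= !lfunE/= Sc// !scalerA tt mulVf ?gt_eqF//.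
    by rewrite scale1r.
  split=> [B sB|B C sB sC|B sB B0].
  - by rewrite /symmx/= !lfunE/= !lfunE/= linearZ/= sB.
  - by rewrite !lfunE/= !lfunE/= frob_dotZl frob_dotC -frob_dotZl frob_dotC.
  - by rewrite !lfunE/= !lfunE/= frob_dotZl mulr_gt0// frob_dot_gt0.
set V := inv_sqrt_op S in Vsym Vsa Vpd VVS *.
have VVA : V (V A) = (t * t) *: A.
  rewrite tt; have := VVS _ sA; rewrite Sc// !linearZ/= => {2}<-.
  by rewrite scalerA mulVf ?gt_eqF// scale1r.
apply/eqP; rewrite -subr_eq0; apply/negPn/negP => B0.
have sB : symmx R k (V A - t *: A).
  by rewrite /symmx/= linearB/= linearZ/= sA (Vsym _ sA).
have := Vpd _ sB B0; set B := (X in frob_dot (V X)).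
have -> : V B = - t *: B.
  rewrite /B linearB/= linearZ/= VVA scalerBr scalerA.
  by rewrite mulNr !scaleNr opprK addrC.
by rewrite frob_dotZl mulNr oppr_gt0 ltNge mulr_ge0 ?frob_dot_ge0 ?ltW.
Qed.

(** The cones are invariant under positive scaling, so in the isotropic case the
    covariance drops out of the statistic. *)
Lemma stratum_stat_isotropic (R : realType) k m (S : 'End('M[R]_k)) Y :
  (0 < k)%N -> selfadjoint_pd S -> isotropic S ->
  stratum_stat m S Y = transition_stat m 0 Y.
Proof.
move=> k0 Spd Siso; have [t t0 VE] := inv_sqrt_op_isotropic k0 Spd Siso.
have im n : inv_sqrt_op S @` rank_cone R n k = rank_cone R n k.
  have scal (a : R) B : 0 < a -> rank_cone R n k B -> rank_cone R n k (a *: B).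
    move=> a0 [[sB B0] Bn]; split; last by rewrite mxrank_scale_nz ?gt_eqF.
    split=> [|x]; first by rewrite /symmx/= linearZ/= sB.
    by rewrite -scalemxAr -scalemxAl mxE mulr_ge0 ?B0// ltW.
  apply/seteqP; split=> [_ [B BK <-]|B BK].
    by rewrite VE; [exact: scal|case: BK => -[]].
  exists (t^-1 *: B); first by apply: scal; rewrite ?invr_gt0.
  rewrite VE ?scalerA ?divff ?scale1r ?gt_eqF//.
  by case: BK => -[sB _] _; rewrite /symmx/= linearZ/= sB.
by rewrite /stratum_stat /transition_stat addr0 -rank_coneT !im.
Qed.

(** * Reflections preserve the planar Gaussian measure *)

Lemma measurable_affine (R : realType) (a b : R) :
  measurable_fun [set: measurableTypeR R]
    (fun x => a * x + b : measurableTypeR R).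
Proof. by apply: measurable_funD => //; exact: measurable_funM. Qed.

Lemma lebesgue_measure_affine_gt0 (R : realType) (a b : R) (A : set R) :
  0 < a -> measurable A ->
  lebesgue_measure A =
    (a%:E * lebesgue_measure ((fun x => (a * x + b)%R) @^-1` A))%E.
Proof.
move=> a0 mA; have mf := measurable_affine a b.
pose mu : {measure set (measurableTypeR R) -> \bar R} :=
  mscale (NngNum (ltW a0)) (pushforward lebesgue_measure
   (fun x => a * x + b : measurableTypeR R)).
rewrite -[RHS]/(mu mf A).
apply: (@lebesgue_measure_unique R (mu mf)) => //.
move=> _ [[x y]] _ <-.
change (lebesgue_measure `]x, y]%classic =
  a%:E * lebesgue_measure ((fun z => (a * z + b)%R) @^-1` `]x, y]%classic))%E.
have -> : (fun z => a * z + b) @^-1` `]x, y]%classic =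
    `](x - b) / a, (y - b) / a]%classic.
  apply/seteqP; split=> z; rewrite /= !in_itv/=.
    move=> /andP[? ?]; rewrite ltr_pdivrMr// ler_pdivlMr//.
    by apply/andP; split; lra.
  by rewrite ltr_pdivrMr// ler_pdivlMr// => /andP[? ?]; apply/andP; split; lra.
rewrite !lebesgue_measure_itv/= !lte_fin ltr_pM2r ?invr_gt0// ltrD2r.
case: ifPn => xy; last by rewrite mule0.
by rewrite -!EFinD -EFinM; congr (_%:E); field; rewrite gt_eqF.
Qed.

Lemma lebesgue_measure_affine (R : realType) (a b : R) (A : set R) :
  a != 0 -> measurable A ->
  lebesgue_measure A =
    (`|a|%:E * lebesgue_measure ((fun x => (a * x + b)%R) @^-1` A))%E.
Proof.
rewrite neq_lt => /orP[a0|a0] mA; last first.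
  by rewrite gtr0_norm//; exact: lebesgue_measure_affine_gt0.
rewrite ltr0_norm// (@lebesgue_measure_affine_gt0 _ (- a) b) ?oppr_gt0//.
congr (_ * _)%E; rewrite -lebesgue_measureN.
  rewrite /pushforward; congr (lebesgue_measure _); apply/seteqP.
  by split=> x /=; rewrite mulrNN.
rewrite -[X in measurable X]setTI.
by apply: measurable_affine.
Qed.

Lemma ge0_integral_affine (R : realType) (a b : R) (f : R -> \bar R) :
  a != 0 -> measurable_fun setT f -> (forall x, 0 <= f x)%E ->
  (\int[lebesgue_measure]_x f x =
   `|a|%:E * \int[lebesgue_measure]_x f (a * x + b)%R)%E.
Proof.
move=> a0 mf f0; have ma := measurable_affine a b.
pose mu : {measure set (measurableTypeR R) -> \bar R} :=
  mscale (NngNum (normr_ge0 a)) (pushforward lebesgue_measure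
   (fun x => a * x + b : measurableTypeR R)).
transitivity (\int[mu ma]_x f x)%E.
  by apply: eq_measure_integral => A mA _; exact: lebesgue_measure_affine.
rewrite ge0_integral_mscale//; congr (_ * _)%E.
by rewrite ge0_integral_pushforward//.
Qed.

Lemma ge0_integral_normal (R : realType) (f : R -> \bar R) :
  measurable_fun setT f -> (forall x, 0 <= f x)%E ->
  (\int[normal_prob 0 1]_x f x =
   \int[lebesgue_measure]_x (f x * (normal_pdf 0 1 x)%:E))%E.
Proof.
move=> mf f0; have dom := @normal_prob_dominates R 0 1.
rewrite -(Radon_Nikodym_SigmaFinite.change_of_variables dom)//.
apply: ae_eq_integral => //.
- apply: emeasurable_funM => //; apply: (measurable_int lebesgue_measure).
  exact: Radon_Nikodym_SigmaFinite.f_integrable.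
- apply: emeasurable_funM => //; apply/measurableT_comp => //=.
  exact: measurable_normal_pdf.
apply: ae_eqe_mul2l => /=; apply: integral_ae_eq => //=.
- exact: Radon_Nikodym_SigmaFinite.f_integrable.
- by apply/measurableT_comp => //; exact: measurable_normal_pdf.
- by move=> E E01 mE; rewrite -Radon_Nikodym_SigmaFinite.f_integral.
Qed.

Lemma measurable_linear2 d (T : measurableType d) (R : realType) (a b : R)
    (X Y : T -> measurableTypeR R) :
  measurable_fun setT X -> measurable_fun setT Y ->
  measurable_fun setT (fun w => a * X w + b * Y w : measurableTypeR R).
Proof.
by move=> mX mY; apply: measurable_funD => //; apply: measurable_funM.
Qed.

(** For fixed [y], the substitution [u = c * x + s * y] turns the second
    coordinate into [(s * u - y) / c]; after exchanging the integrals, a second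
    affine substitution, in [y], finishes. The Jacobians [c^-1] and [c]
    cancel. *)
Lemma lebesgue2_reflection (R : realType) (c s : R)
    (F : measurableTypeR R * measurableTypeR R -> \bar R) :
  c != 0 -> c ^+ 2 + s ^+ 2 = 1 ->
  measurable_fun setT F -> (forall z, 0 <= F z)%E ->
  (\int[lebesgue_measure]_x \int[lebesgue_measure]_y
      F (c * x + s * y, s * x - c * y)%R =
   \int[lebesgue_measure]_x \int[lebesgue_measure]_y F (x, y))%E.
Proof.
move=> c0 cs mF F0; pose mu := @lebesgue_measure R.
have mL (a b a' b' : R) :
    measurable_fun [set: measurableTypeR R * measurableTypeR R]
    (fun z => F (a * z.1 + b * z.2, a' * z.1 + b' * z.2)%R).
  apply: measurableT_comp => //; apply/measurable_fun_pairP; split.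
    exact: measurable_linear2.
  exact: measurable_linear2.
transitivity (\int[mu]_y \int[mu]_x F (c * x + s * y, s * x - c * y)%R)%E.
  rewrite -(@fubini_tonelli _ _ _ _ _ mu mu
    (fun z => F (c * z.1 + s * z.2, s * z.1 - c * z.2)%R))//.
  by under eq_fun do rewrite -mulNr; exact: mL.
have mG : measurable_fun [set: measurableTypeR R * measurableTypeR R]
    (fun z => F (z.1, (s * z.1 - z.2) / c)%R).
  have := mL 1 0 (s / c) (- c^-1); congr measurable_fun; apply/funext => z.
  by rewrite mul1r mul0r addr0; congr (F (_, _)); field.
transitivity (\int[mu]_y (`|c^-1|%:E * \int[mu]_u F (u, (s * u - y) / c)%R))%E.
  apply: eq_integral => y _.
  rewrite (@ge0_integral_affine _ c (s * y)
    (fun u => F (u, (s * u - y) / c)%R))//.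
    rewrite muleA -EFinM -normrM mulVf// normr1 mul1e.
    apply: eq_integral => x _; congr (F (_, _)).
    rewrite [X in X / c](_ : _ = c * (s * x - c * y)); first by field.
    by rewrite -[X in _ - X]mul1r -cs; ring.
  have := measurable_fun_pair1 (y : measurableTypeR R) mG; exact.
transitivity (`|c^-1|%:E * \int[mu]_y \int[mu]_u F (u, (s * u - y) / c)%R)%E.
  rewrite ge0_integralZl//.
  - have := measurable_fun_fubini_tonelli_G (m1 := mu) _ mG (fun=> F0 _).
    exact.
  - by move=> y _; apply: integral_ge0.
rewrite -(@fubini_tonelli _ _ _ _ _ mu mu
  (fun z => F (z.1, (s * z.1 - z.2) / c)%R))//=.
rewrite -ge0_integralZl//; last 2 first.
  - have := measurable_fun_fubini_tonelli_F (m2 := mu) _ mG (fun=> F0 _).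
    exact.
  - by move=> y _; apply: integral_ge0.
apply: eq_integral => u _.
rewrite (@ge0_integral_affine _ (- c^-1) (s * u / c)
  (fun v => F (u, v)))//; last 2 first.
  - by rewrite oppr_eq0 invr_eq0.
  - exact: measurableT_comp.
rewrite normrN; congr (_ * _)%E; apply: eq_integral => y _.
by congr (F (_, _)); field.
Qed.

Lemma normal_pdf01E (R : realType) (x : R) :
  normal_pdf 0 1 x = normal_peak 1 * expR (- x ^+ 2 / 2).
Proof.
by rewrite normal_pdfE ?oner_eq0// /normal_fun subr0 expr1n.
Qed.

Lemma normal_prob_indic (R : realType) (A : set R) : measurable A ->
  (normal_prob 0 1 A =
   \int[lebesgue_measure]_x (\1_A x * normal_pdf 0 1 x)%:E)%E.
Proof.
move=> mA; rewrite /normal_prob integral_mkcond; apply: eq_integral => x _.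
rewrite patchE indicE; case: ifPn => xA; first by rewrite mul1r.
by rewrite mul0r.
Qed.

Lemma normal_pdf_reflection (R : realType) (c s x y : R) :
  c ^+ 2 + s ^+ 2 = 1 ->
  normal_pdf 0 1 (c * x + s * y) * normal_pdf 0 1 (s * x - c * y) =
  normal_pdf 0 1 x * normal_pdf 0 1 y.
Proof.
move=> cs; rewrite !normal_pdf01E mulrACA [RHS]mulrACA; congr (_ * _).
rewrite -!expRD; congr expR.
have : (c ^+ 2 + s ^+ 2) * (x ^+ 2 + y ^+ 2) = x ^+ 2 + y ^+ 2.
  by rewrite cs mul1r.
lra.
Qed.

Lemma measurable_reflection_preimage (R : realType) (c s : R) (A B : set R) :
  measurable A -> measurable B -> measurable
    [set z : measurableTypeR R * measurableTypeR R |
      A (c * z.1 + s * z.2)%R /\ B (s * z.1 - c * z.2)%R].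
Proof.
move=> mA mB; set D := [set z : measurableTypeR R * measurableTypeR R | _].
pose RR := (measurableTypeR R * measurableTypeR R)%type.
have -> : D = (fun z : RR => c * z.1 + s * z.2) @^-1` A `&`
              (fun z : RR => s * z.1 - c * z.2) @^-1` B by [].
apply: measurableI; rewrite -[X in measurable X]setTI.
  exact: (measurable_linear2 (T := measurableTypeR R * measurableTypeR R)%type).
under eq_fun do rewrite -mulNr.
exact: measurable_linear2.
Qed.

(** The density is invariant because [c^2 + s^2 = 1], Lebesgue measure by the
    preceding substitutions. *)
Lemma normal2_reflection (R : realType) (c s : R) (A B : set R) :
  c != 0 -> c ^+ 2 + s ^+ 2 = 1 -> measurable A -> measurable B ->
  ((normal_prob 0 1 \x normal_prob 0 1)
     [set z : measurableTypeR R * measurableTypeR R |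
       A (c * z.1 + s * z.2)%R /\ B (s * z.1 - c * z.2)%R] =
   normal_prob 0 1 A * normal_prob 0 1 B)%E.
Proof.
move=> c0 cs mA mB; pose mu := @lebesgue_measure R.
set D := [set z : measurableTypeR R * measurableTypeR R | _].
have mD : measurable D by exact: measurable_reflection_preimage.
pose phi := @normal_pdf R 0 1.
have mphi : measurable_fun setT phi := measurable_normal_pdf 0 1.
pose F (z : measurableTypeR R * measurableTypeR R) :=
  (\1_A z.1 * phi z.1 * (\1_B z.2 * phi z.2))%:E.
have mF : measurable_fun setT F.
  apply/measurable_EFinP; apply: measurable_funM; apply: measurable_funM.
  - exact: (measurableT_comp (measurable_indic mA)).
  - exact: (measurableT_comp mphi).
  - exact: (measurableT_comp (measurable_indic mB)).
  - exact: (measurableT_comp mphi).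
have F0 z : (0 <= F z)%E.
  by rewrite lee_fin !mulr_ge0// normal_pdf_ge0.
transitivity (\int[mu]_x \int[mu]_y F (c * x + s * y, s * x - c * y)%R)%E.
  rewrite /product_measure1 ge0_integral_normal//; last first.
    exact: measurable_fun_xsection.
  apply: eq_integral => x _.
  rewrite /= normal_prob_indic; last exact: measurable_xsection.
  have mI : measurable_fun setT (fun y : measurableTypeR R =>
      (\1_(xsection D x) y * phi y)%:E).
    apply/measurable_EFinP/measurable_funM => //.
    by apply: measurable_indic; exact: measurable_xsection.
  have FE y : F (c * x + s * y, s * x - c * y) =
      ((phi x)%:E * (\1_(xsection D x) y * phi y)%:E)%E.
    rewrite -EFinM; congr (_%:E); rewrite [LHS]mulrACA.
    rewrite [X in _ * X = _](_ : _ = phi x * phi y).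
      rewrite [X in X * _ = _](_ : _ = \1_(xsection D x) y).
        by rewrite mulrCA.
      rewrite [RHS]indicE /indic -natrM mulnb; congr (_%:R); congr nat_of_bool.
      apply/andP/idP => [[/set_mem DA /set_mem DB]|/set_mem/set_mem[DA DB]].
        by apply/mem_set/mem_set; split.
      by split; apply/mem_set.
    exact: normal_pdf_reflection.
  transitivity (\int[mu]_y ((phi x)%:E * (\1_(xsection D x) y * phi y)%:E))%E.
    rewrite ge0_integralZl//; first exact: muleC.
    - by move=> y _; rewrite lee_fin mulr_ge0// normal_pdf_ge0.
    - by rewrite lee_fin normal_pdf_ge0.
  by apply: eq_integral => y _; exact/esym/FE.
rewrite lebesgue2_reflection//.
rewrite !normal_prob_indic// -ge0_integralZr//; last 3 first.
- by apply/measurable_EFinP; apply: measurable_funM => //;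
    exact: measurable_indic.
- by move=> x _; rewrite lee_fin mulr_ge0// normal_pdf_ge0.
- by apply: integral_ge0 => x _; rewrite lee_fin mulr_ge0// normal_pdf_ge0.
apply: eq_integral => x _; rewrite -ge0_integralZl//.
- by apply/measurable_EFinP; apply: measurable_funM => //;
    exact: measurable_indic.
- by move=> y _; rewrite lee_fin mulr_ge0// normal_pdf_ge0.
- by rewrite lee_fin mulr_ge0// normal_pdf_ge0.
Qed.

(** * Gaussian vectors under isometries *)

Section gaussian_families.
Context d (T : measurableType d) (R : realType) (P : probability T R).
Local Notation gamma := (@normal_prob R 0 1).
Local Notation GR := (measurableTypeR R).

Lemma normal_prob_opp (A : set R) : measurable A ->
  gamma (-%R @^-1` A) = gamma A.
Proof.
move=> mA; have mNA : measurable ((-%R : R -> R) @^-1` A).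
  rewrite -[X in measurable X]setTI; exact: oppr_measurable.
rewrite !normal_prob_indic//.
rewrite [RHS](@ge0_integral_affine _ (-1) 0)//; last 2 first.
- apply/measurable_EFinP; apply: measurable_funM; first exact: measurable_indic.
  exact: measurable_normal_pdf.
- by move=> x; rewrite lee_fin mulr_ge0// normal_pdf_ge0.
rewrite normrN normr1 mul1e; apply: eq_integral => x _.
rewrite mulN1r addr0; congr (_ * _)%:E.
by rewrite !normal_pdf01E sqrrN.
Qed.

(** On the event [E], the coordinates of [Z] are independent standard Gaussian
    variables that are also independent of [E]. Carrying the event along makes
    it possible to condition on some coordinates while the others are
    transformed, without conditional measures or product measures in several
    variables. *)
Definition gaussian_on (E : set T) n (Z : T -> 'cV[R]_n) : Prop :=
  [/\ measurable E, forall i, measurable_fun setT (fun w => Z w i 0) &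
    forall B : 'I_n -> set R, (forall i, measurable (B i)) ->
      P (E `&` [set w | forall i, B i (Z w i 0)]) =
      (P E * \prod_(i < n) gamma (B i))%E].

Lemma measurable_cylinder (I : finType) (Z : T -> I -> R) (B : I -> set R) :
  (forall i, measurable_fun setT (Z ^~ i)) -> (forall i, measurable (B i)) ->
  measurable [set w | forall i, B i (Z w i)].
Proof.
move=> mZ mB.
rewrite (_ : [set _ | _] = \bigcap_(i in [set: I]) (Z ^~ i @^-1` B i)).
  apply: fin_bigcap_measurable; first exact: finite_finset.
  by move=> i _; rewrite -[X in measurable X]setTI; exact: mZ.
by apply/seteqP; split=> w /= H i; [move=> _; exact: H|exact: (H i)].
Qed.

(** Rectangles generate the product sigma-algebra and are stable under
    intersection. *)
Lemma gaussian_pair_law (E : set T) (X Y : T -> R) (D : set (GR * GR)) :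
  measurable E -> measurable_fun setT X -> measurable_fun setT Y ->
  (forall A B : set R, measurable A -> measurable B ->
    P (E `&` (X @^-1` A `&` Y @^-1` B)) = (P E * (gamma A * gamma B))%E) ->
  measurable D ->
  P (E `&` [set w | D (X w, Y w)]) = (P E * (gamma \x gamma) D)%E.
Proof.
move=> mE mX mY XY mD.
have PE0 : 0 <= fine (P E) by exact: fine_ge0.
pose XYf w : (GR * GR)%type := (X w, Y w).
have mXY : measurable_fun setT XYf by apply/measurable_fun_pairP.
pose m1 : {measure set (GR * GR) -> \bar R} := pushforward (mrestr P mE) XYf.
pose m2 : {measure set (GR * GR) -> \bar R} :=
  mscale (NngNum PE0) (gamma \x gamma)%E.
pose G : set (set (GR * GR)) :=
  [set A `*` B | A in measurable & B in measurable].
suff -> : P (E `&` [set w | D (X w, Y w)]) = m2 D.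
  by rewrite /m2/= /mscale/= fineK// fin_num_measure.
have -> : P (E `&` [set w | D (X w, Y w)]) = m1 mXY D.
  by rewrite /m1/= /pushforward /mrestr setIC.
apply: (measure_unique G (fun=> setT)) => //.
- by rewrite measurable_prod_measurableType.
- move=> _ _ [A1 mA1 [B1 mB1 <-]] [A2 mA2 [B2 mB2 <-]].
  rewrite -setXI; exists (A1 `&` A2); first exact: measurableI.
  by exists (B1 `&` B2) => //; exact: measurableI.
- by move=> i; exists setT => //; exists setT => //; rewrite setXTT.
- by rewrite bigcup_const.
- move=> _ [A mA [B mB <-]].
  transitivity (P E * (gamma A * gamma B))%E.
    by rewrite -XY// setIC.
  by rewrite /m2/= /mscale/= fineK ?fin_num_measure// product_measure1E.
- move=> _; rewrite /m1/= /pushforward /mrestr/= preimage_setT setTI.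
  by rewrite ltey_eq fin_num_measure.
Qed.

Definition gaussian_preserving m n (A : 'M[R]_(m, n)) : Prop :=
  forall E (Z : T -> 'cV[R]_n),
    gaussian_on E Z -> gaussian_on E (fun w => A *m Z w).

Lemma gaussian_preserving_comp m n p (A : 'M[R]_(m, n)) (B : 'M[R]_(n, p)) :
  gaussian_preserving A -> gaussian_preserving B ->
  gaussian_preserving (A *m B).
Proof.
move=> gA gB E Z gZ; rewrite (_ : (fun _ => _) = fun w => A *m (B *m Z w)).
  exact/gA/gB.
by apply/funext => w; rewrite mulmxA.
Qed.

Lemma gaussian_preserving1 n : gaussian_preserving (1%:M : 'M[R]_n).
Proof.
move=> E Z; rewrite (_ : (fun _ => _) = Z)//.
by apply/funext => w; rewrite mul1mx.
Qed.

Lemma measurable_mulmx m n (A : 'M[R]_(m, n)) (Z : T -> 'cV[R]_n) :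
  (forall i, measurable_fun setT (fun w => Z w i 0)) ->
  forall i, measurable_fun setT (fun w => (A *m Z w) i 0).
Proof.
move=> mZ i; under eq_fun do rewrite mxE.
by apply: measurable_sum => j; exact: measurable_funM.
Qed.

Lemma gaussian_on_coord n (E : set T) (Z : T -> 'cV[R]_n) (B : 'I_n -> set R) :
  gaussian_on E Z -> (forall i, measurable (B i)) ->
  measurable (E `&` [set w | forall i, B i (Z w i 0)]).
Proof.
move=> [mE mZ _] mB; apply: measurableI => //.
exact: (measurable_cylinder (Z := fun w i => Z w i 0)).
Qed.

Lemma gaussian_on_setIT n p (E : set T) (X : T -> 'cV[R]_n)
    (Y : T -> 'cV[R]_p) :
  gaussian_on (E `&` [set w | forall i, setT (Y w i 0)]) X -> gaussian_on E X.
Proof. by rewrite (_ : E `&` _ = E)//; apply/seteqP; split=> w //= []. Qed.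

(** Independence of the two blocks, expressed by conditioning the second on
    all the events that involve the first. *)
Lemma gaussian_on_col_mx m n (E : set T) (X : T -> 'cV[R]_m)
    (Y : T -> 'cV[R]_n) :
  gaussian_on E (fun w => col_mx (X w) (Y w)) <->
  gaussian_on E X /\ forall B : 'I_m -> set R, (forall i, measurable (B i)) ->
    gaussian_on (E `&` [set w | forall i, B i (X w i 0)]) Y.
Proof.
have cylE (B : 'I_(m + n) -> set R) :
    [set w | forall i, B i (col_mx (X w) (Y w) i 0)] =
    [set w | forall i, B (lshift n i) (X w i 0)] `&`
    [set w | forall i, B (rshift m i) (Y w i 0)].
  apply/seteqP; split=> w /=.
    move=> Bw; split=> i; first by have := Bw (lshift n i); rewrite col_mxEu.
    by have := Bw (rshift m i); rewrite col_mxEd.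
  move=> [BX BY] i; rewrite -(splitK i).
  by case: (fintype.split i) => j /=; rewrite ?col_mxEu ?col_mxEd.
pose join (B : 'I_m -> set R) (C : 'I_n -> set R) (i : 'I_(m + n)) :=
  match fintype.split i with inl j => B j | inr j => C j end.
have joinl B C i : join B C (lshift n i) = B i.
  by rewrite /join (unsplitK (inl i)).
have joinr B C i : join B C (rshift m i) = C i.
  by rewrite /join (unsplitK (inr i)).
have mjoin B C : (forall i, measurable (B i)) -> (forall i, measurable (C i)) ->
    forall i, measurable (join B C i).
  by move=> mB mC i; rewrite /join; case: fintype.split.
split=> [[mE mZ EZ]|[gX gY]].
  have mX i : measurable_fun setT (fun w => X w i 0).
    by have := mZ (lshift n i); under eq_fun do rewrite col_mxEu.
  have mY i : measurable_fun setT (fun w => Y w i 0).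
    by have := mZ (rshift m i); under eq_fun do rewrite col_mxEd.
  have EXY B C : (forall i, measurable (B i)) -> (forall i, measurable (C i)) ->
      P (E `&` [set w | forall i, B i (X w i 0)] `&`
          [set w | forall i, C i (Y w i 0)]) =
      (P E * \prod_(i < m) gamma (B i) * \prod_(i < n) gamma (C i))%E.
    move=> mB mC; have := EZ _ (mjoin _ _ mB mC).
    rewrite cylE setIA big_split_ord/=.
    under [X in (_ * (X * _))%E]eq_bigr do rewrite joinl.
    under [X in (_ * (_ * X))%E]eq_bigr do rewrite joinr.
    rewrite muleA => <-; congr (P (_ `&` _ `&` _)); apply/funext => w /=.
      by apply/propext; split=> H i; have := H i; rewrite joinl.
    by apply/propext; split=> H i; have := H i; rewrite joinr.
  have gX : gaussian_on E X.
    split=> // B mB; have := EXY B (fun=> setT) mB (fun=> measurableT).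
    rewrite [X in (_ * X)%E]big1 ?mule1 => [<-|i _]; last first.
      exact: probability_setT.
    by congr (P _); apply/seteqP; split=> w /=; tauto.
  split=> // B mB; split=> //; first exact: gaussian_on_coord gX mB.
  by move=> C mC; rewrite EXY//; case: gX => _ _ ->.
have mX : forall i, measurable_fun setT (fun w => X w i 0) by case: gX.
have mY : forall i, measurable_fun setT (fun w => Y w i 0).
  by case: (gY (fun=> setT) (fun=> measurableT)).
split; first by case: gX.
  move=> i; rewrite -(splitK i); case: (fintype.split i) => j /=.
    by under eq_fun do rewrite col_mxEu; exact: mX.
  by under eq_fun do rewrite col_mxEd; exact: mY.
move=> B mB; rewrite cylE setIA.
have [_ _ EY] := gY (fun i => B (lshift n i)) (fun i => mB _).
have [_ _ EX] := gX.
rewrite (EY (fun i => B (rshift m i)))// (EX (fun i => B (lshift n i)))//.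
by rewrite big_split_ord/= muleA.
Qed.

(** The same conditioning with the roles of the blocks exchanged. *)
Lemma gaussian_on_setI m n (E : set T) (X : T -> 'cV[R]_m) (Y : T -> 'cV[R]_n)
    (C : 'I_n -> set R) :
  gaussian_on E (fun w => col_mx (X w) (Y w)) -> (forall i, measurable (C i)) ->
  gaussian_on (E `&` [set w | forall i, C i (Y w i 0)]) X.
Proof.
move=> /gaussian_on_col_mx[gX gY] mC.
have [mE mX EX] := gX.
have [_ mY _] := gY (fun=> setT) (fun=> measurableT).
have gE : gaussian_on E Y.
  exact: gaussian_on_setIT (gY (fun=> setT) (fun=> measurableT)).
have [_ _ EY] := gE.
split=> //; first exact: gaussian_on_coord gE mC.
move=> B mB; rewrite EY// setIAC.
have [_ _ EBY] := gY _ mB.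
by rewrite EBY// EX// muleAC.
Qed.

(** First [B] acts while the upper block is conditioned upon, then [A] acts
    while the new lower block is. *)
Lemma gaussian_preserving_block m n m' n' (A : 'M[R]_(m, n))
    (B : 'M[R]_(m', n')) :
  gaussian_preserving A -> gaussian_preserving B ->
  gaussian_preserving (block_mx A 0 0 B).
Proof.
move=> gA gB E Z gZ.
have ZE : Z = fun w => col_mx (usubmx (Z w)) (dsubmx (Z w)).
  by apply/funext => w; rewrite vsubmxK.
rewrite ZE in gZ.
have -> : (fun w => block_mx A 0 0 B *m Z w) =
    fun w => col_mx (A *m usubmx (Z w)) (B *m dsubmx (Z w)).
  apply/funext => w; rewrite -{1}(vsubmxK (Z w)) mul_block_col !mul0mx.
  by rewrite addr0 add0r.
have /gaussian_on_col_mx[gX gY] := gZ.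
have {}gY C : (forall i, measurable (C i)) ->
    gaussian_on (E `&` [set w | forall i, C i (usubmx (Z w) i 0)])
      (fun w => B *m dsubmx (Z w)).
  by move=> mC; apply: gB; exact: gY.
have {gZ gX gY} gZ :
    gaussian_on E (fun w => col_mx (usubmx (Z w)) (B *m dsubmx (Z w))).
  by apply/gaussian_on_col_mx.
have gAC C : (forall i, measurable (C i)) ->
    gaussian_on (E `&` [set w | forall i, C i ((B *m dsubmx (Z w)) i 0)])
      (fun w => A *m usubmx (Z w)).
  by move=> mC; apply: gA; exact: gaussian_on_setI gZ mC.
have gBY : gaussian_on E (fun w => B *m dsubmx (Z w)).
  have /gaussian_on_col_mx[_ gY] := gZ.
  exact: gaussian_on_setIT (gY (fun=> setT) (fun=> measurableT)).
have gAX : gaussian_on E (fun w => A *m usubmx (Z w)).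
  exact: gaussian_on_setIT (gAC (fun=> setT) (fun=> measurableT)).
apply/gaussian_on_col_mx; split=> //.
move=> C mC; have [mE mBY EBY] := gBY.
have [_ mAX _] := gAC (fun=> setT) (fun=> measurableT).
split=> //; first exact: gaussian_on_coord gAX mC.
move=> D mD; rewrite setIAC; have [_ _ EAC] := gAC D mD.
have [_ _ EAX] := gAX.
by rewrite EAC// EBY// EAX// muleAC.
Qed.

Lemma gaussian_preserving_opp n : gaussian_preserving (- 1%:M : 'M[R]_n).
Proof.
move=> E Z [mE mZ EZ]; have mNB (B : set R) : measurable B ->
    measurable ((-%R : R -> R) @^-1` B).
  by move=> mB; rewrite -[X in measurable X]setTI; exact: oppr_measurable.
split=> // [|B mB]; first exact: measurable_mulmx.
transitivity (P (E `&` [set w | forall i, (-%R @^-1` B i) (Z w i 0)])).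
  congr (P (_ `&` _)); apply/funext => w; apply/propext.
  by split=> H i; have := H i; rewrite mulNmx mul1mx mxE.
rewrite (EZ (fun i => -%R @^-1` B i)); last by move=> i; exact: mNB.
by congr (_ * _)%E; apply: eq_bigr => i _; exact: normal_prob_opp.
Qed.

Lemma forall_ord2 (Q : 'I_2 -> Prop) : (forall i, Q i) <-> Q 0 /\ Q 1.
Proof.
split=> [H|[Q0 Q1] i]; first by split; exact: H.
move: Q0 Q1; case: i => [[|[|//]] H]; [move=> + _|move=> _];
  by congr Q; exact: val_inj.
Qed.

Definition reflection2 (c s : R) : 'M[R]_2 :=
  \matrix_(i, j) if i == j then (if i == 0 then c else - c) else s.

Lemma reflection2_orthogonal (c s : R) : c ^+ 2 + s ^+ 2 = 1 ->
  reflection2 c s *m (reflection2 c s)^T = 1%:M.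
Proof.
move=> cs; apply/matrixP; apply/forall_ord2; split; apply/forall_ord2; split;
  rewrite !mxE !big_ord_recl big_ord0 !mxE/=; lra.
Qed.

Lemma gaussian_preserving_reflection2 (c s : R) :
  0 <= s -> c ^+ 2 + s ^+ 2 = 1 -> gaussian_preserving (reflection2 c s).
Proof.
move=> s0 cs E Z [mE mZ EZ]; split=> // [|B mB]; first exact: measurable_mulmx.
pose D := [set z : GR * GR |
  B 0 (c * z.1 + s * z.2)%R /\ B 1 (s * z.1 - c * z.2)%R].
transitivity (P (E `&` [set w | D (Z w 0 0, Z w 1 0)])).
  congr (P (_ `&` _)); apply/funext => w; apply/propext.
  apply: (iff_trans (forall_ord2 _)).
  rewrite /D/= !mxE !big_ord_recl !big_ord0 !mxE /= !addr0 mulNr.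
  by rewrite (_ : lift ord0 ord0 = 1)//; exact: val_inj.
rewrite (@gaussian_pair_law E (fun w => Z w 0 0) (fun w => Z w 1 0) D
  mE (mZ 0) (mZ 1)).
- rewrite big_ord_recl big_ord1.
  rewrite (_ : lift ord0 ord0 = 1); last exact: val_inj.
  congr (_ * _)%E; have [c0|c0] := eqVneq c 0; last first.
    exact: normal2_reflection.
  (* the reflection is then the exchange of the two coordinates *)
  have s1 : s = 1.
    move: cs; rewrite c0 expr0n add0r => /eqP.
    by rewrite sqrf_eq1 => /orP[/eqP//|/eqP sN1]; move: s0; rewrite sN1; lra.
  have -> : D = B 1 `*` B 0.
    apply/seteqP; split=> z;
      by rewrite /D/= c0 s1 !mul0r !mul1r subr0 add0r; tauto.
  by rewrite /= product_measure1E; [exact: muleC|exact: mB|exact: mB].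
- move=> A C mA mC.
  transitivity (P (E `&`
      [set w | forall i : 'I_2, (if i == 0 then A else C) (Z w i 0)])).
    congr (P (_ `&` _)); apply/funext => w; apply/propext.
    by apply: iff_sym; exact: forall_ord2.
  rewrite (EZ (fun i => if i == 0 then A else C)); last by move=> i; case: ifP.
  by rewrite big_ord_recl big_ord1.
- exact: measurable_reflection_preimage.
Qed.

(** By induction on the dimension: the tail of the unit vector [a] is [r * b]
    with [b] a unit vector, [V] is the matrix obtained for [b], and a reflection
    in the plane of the first two coordinates combines the first coordinate
    with the one in the direction [b]. *)
Lemma gaussian_preserving_completion n (a : 'rV[R]_n.+1) : a *m a^T = 1%:M ->
  exists V : 'M[R]_n.+1,
    [/\ V *m V^T = 1%:M, row 0 V = a & gaussian_preserving V].
Proof.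
elim: n a => [|n IH] a a1.
  have : a 0 0 ^+ 2 = 1.
    by move/matrixP: a1 => /(_ 0 0); rewrite !mxE big_ord1 mxE expr2.
  move/eqP; rewrite sqrf_eq1 => /orP[/eqP a0|/eqP a0].
    exists 1%:M; split; [by rewrite trmx1 mulmx1| |exact: gaussian_preserving1].
    by apply/rowP => j; rewrite !mxE !ord1 a0.
  exists (- 1%:M); split; last exact: gaussian_preserving_opp.
    by rewrite linearN/= trmx1 mulNmx mulmxN opprK mulmx1.
  by apply/rowP => j; rewrite !mxE !ord1 a0.
have a_sqr : a 0 0 ^+ 2 + \sum_(j < n.+1) a 0 (lift ord0 j) ^+ 2 = 1.
  move/matrixP: a1 => /(_ 0 0).
  rewrite !mxE big_ord_recl mxE -expr2 eqxx mulr1n => <-.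
  by congr (_ + _); apply: eq_bigr => j _; rewrite mxE expr2.
pose r := Num.sqrt (\sum_(j < n.+1) a 0 (lift ord0 j) ^+ 2).
have r2 : r ^+ 2 = \sum_(j < n.+1) a 0 (lift ord0 j) ^+ 2.
  by rewrite sqr_sqrtr// sumr_ge0// => j _; rewrite sqr_ge0.
have [b [b1 ab]] : exists b : 'rV[R]_n.+1, b *m b^T = 1%:M /\
    forall j, a 0 (lift ord0 j) = r * b 0 j.
  have [r0|r0] := eqVneq r 0.
    (* the tail vanishes, and any unit vector serves as its direction *)
    exists (delta_mx 0 0); split.
      rewrite trmx_delta mul_delta_mx.
      by apply/matrixP => i j; rewrite !mxE !ord1.
    move=> j; rewrite r0 mul0r; apply/eqP; rewrite -sqrf_eq0; move/eqP: r2.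
    rewrite r0 expr0n eq_sym psumr_eq0 => [/allP|? _]; last exact: sqr_ge0.
    by apply; exact: mem_index_enum.
  exists (\row_j (r^-1 * a 0 (lift ord0 j))); split; last first.
    by move=> j; rewrite mxE mulrA divff// mul1r.
  apply/matrixP => i j; rewrite !ord1 mxE mxE/=.
  under eq_bigr do rewrite !mxE -expr2 exprMn.
  by rewrite -mulr_sumr -r2 -exprMn mulVf// expr1n.
have [V [V1 Vb gV]] := IH b b1.
have cs : a 0 0 ^+ 2 + r ^+ 2 = 1 by rewrite r2.
pose F : 'M[R]_(2 + n) := block_mx (reflection2 (a 0 0) r) 0 0 1%:M.
pose K : 'M[R]_(1 + n.+1) := block_mx 1%:M 0 0 V.
have gF : gaussian_preserving F.
  apply: gaussian_preserving_block; last exact: gaussian_preserving1.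
  by apply: gaussian_preserving_reflection2; rewrite ?sqrtr_ge0.
have gK : gaussian_preserving K.
  by apply: gaussian_preserving_block => //; exact: gaussian_preserving1.
have FF : F *m F^T = 1%:M.
  rewrite /F tr_block_mx mulmx_block !trmx0 trmx1 !mulmx0 !mul0mx mulmx1.
  by rewrite !addr0 add0r reflection2_orthogonal// -scalar_mx_block.
have KK : K *m K^T = 1%:M.
  rewrite /K tr_block_mx mulmx_block !trmx0 trmx1 !mulmx0 !mul0mx mulmx1.
  by rewrite !addr0 add0r V1 -scalar_mx_block.
(* F and K are blocked differently, hence the common type for their product *)
pose F' : 'M[R]_n.+2 := F; pose K' : 'M[R]_n.+2 := K.
exists (F' *m K'); split.
- by rewrite trmx_mul mulmxA -(mulmxA F') KK mulmx1.
- have F'E (i : 'I_n.+2) t : i = @lshift 2 n 0 :> 'I_(2 + n) ->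
      F' i t = F (@lshift 2 n 0) t by move=> ->.
  have e0 : 0 = @lshift 2 n 0 :> 'I_(2 + n) by exact: val_inj.
  have F0r i : F' 0 (rshift 2 i) = 0 by rewrite F'E// block_mxEur mxE.
  have F00 : F' 0 (@lshift 2 n 0) = a 0 0 by rewrite F'E// block_mxEul mxE.
  have F01 : F' 0 (@lshift 2 n 1) = r by rewrite F'E// block_mxEul mxE.
  apply/rowP => j; rewrite [LHS]mxE [LHS]mxE.
  rewrite (@big_split_ord _ _ _ 2 n)/= [X in _ + X]big1 ?addr0; last first.
    by move=> i _; rewrite F0r mul0r.
  rewrite !big_ord_recl big_ord0 addr0 F00.
  rewrite (_ : lift ord0 ord0 = 1) ?F01; last exact: val_inj.
  have K0 : K' (@lshift 2 n 0) j = K (@lshift 1 n.+1 0) j.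
    by congr (K _ _); exact: val_inj.
  have K1 : K' (@lshift 2 n 1) j = K (@rshift 1 n.+1 0) j.
    by congr (K _ _); exact: val_inj.
  rewrite K0 K1 -(@splitK 1 n.+1 j); case: (@fintype.split 1 n.+1 j) => t /=.
    rewrite block_mxEul block_mxEdl !mxE !ord1 eqxx mulr1 mulr0 addr0.
    by congr (a _ _); exact: val_inj.
  rewrite block_mxEur block_mxEdr !mxE mulr0 add0r.
  move/rowP: Vb => /(_ t); rewrite mxE => ->; rewrite -ab.
  by congr (a _ _); exact: val_inj.
- exact: gaussian_preserving_comp.
Qed.
End gaussian_families.

(** * Laws of functions of Gaussian vectors *)

(** The infimal-convolution idea: [f (Z w) < c] holds if and only if, for some
    point [h] with rational coordinates, [f h] plus [L] times the distance to
    [h] is below [c]. This is a countable union of events that are measurable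
    coordinate by coordinate. For [L <= 0] the function is constant. *)
Lemma measurable_lipschitz d (T : measurableType d) (R : realType) n
    (Z : T -> 'cV[R]_n) (f : 'cV[R]_n -> R) (L : R) :
  (forall i, measurable_fun setT (fun w => Z w i 0)) ->
  (forall x y, f x <= f y + L * \sum_i `|x i 0 - y i 0|) ->
  measurable_fun setT (f \o Z).
Proof.
move=> mZ fL; have [L0|L0] := leP L 0.
  have fc x y : f x = f y.
    have le1 u v : f u <= f v.
      apply: (le_trans (fL u v)); rewrite gerDl mulr_le0_ge0// sumr_ge0//.
    by apply/eqP; rewrite eq_le !le1.
  rewrite (_ : f \o Z = cst (f 0)); first exact: measurable_cst.
  by apply/funext => w; exact: fc.
apply: (measurability _ (RGenInftyO.measurableE R)) => _ [_ [c ->] <-].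
rewrite setTI.
pose q2r (g : {ffun 'I_n -> rat}) : 'cV[R]_n := \col_i ratr (g i).
pose S (g : {ffun 'I_n -> rat}) :=
  [set w | f (q2r g) + L * \sum_i `|Z w i 0 - q2r g i 0| < c].
pose S' k := if unpickle k is Some g then S g else set0.
have -> : (f \o Z) @^-1` `]-oo, c[%classic = \bigcup_k S' k.
  apply/seteqP; split=> w /=; rewrite in_itv/=.
    (* [f h] and the distance term each use less than half of the slack *)
    move=> fc; pose e := (c - f (Z w)) / (L * n.+1%:R *+ 2).
    have e0 : 0 < e.
      by rewrite divr_gt0 ?subr_gt0// mulrn_wgt0// mulr_gt0.
    have /fin_all_exists[g0 gP] : forall i,
        exists q : rat, `|Z w i 0 - ratr q| < e.
      move=> i; have [|q] := @rat_in_itvoo R (Z w i 0 - e) (Z w i 0 + e).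
        by rewrite ltrD2l gtrN.
      by rewrite in_itv/= => /andP[q1 q2]; exists q; rewrite ltr_norml; lra.
    exists (pickle [ffun i => g0 i]) => //; rewrite /S' pickleK /S/=.
    set h := q2r _; have hE i : `|Z w i 0 - h i 0| <= e.
      by rewrite /h mxE ffunE; exact/ltW.
    have Sle : \sum_i `|Z w i 0 - h i 0| <= n%:R * e.
      apply: (le_trans (ler_sum _ (fun i _ => hE i))).
      by rewrite sumr_const card_ord mulr_natl.
    have := fL h (Z w).
    rewrite (eq_bigr (fun i => `|Z w i 0 - h i 0|)); last first.
      by move=> i _; rewrite distrC.
    have LS : L * \sum_i `|Z w i 0 - h i 0| <= L * (n%:R * e).
      by rewrite ler_pM2l.
    have : L * (n.+1%:R * e) * 2 = c - f (Z w).
      by rewrite /e -mulr_natr; field; rewrite ?gt_eqF//= ?pnatr_eq0.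
    have : L * (n.+1%:R * e) = L * (n%:R * e) + L * e.
      by rewrite -natr1; ring.
    have : 0 < L * e by rewrite mulr_gt0.
    lra.
  move=> [k _]; rewrite /S'; case: unpickle => // g; rewrite /S/=.
  by apply: le_lt_trans; exact: fL.
apply: bigcupT_measurable => k; rewrite /S'; case: unpickle => // g.
rewrite /S -[X in measurable X]setTI.
pose h w := f (q2r g) + L * \sum_i `|Z w i 0 - q2r g i 0|.
have mh : measurable_fun setT h.
  apply: measurable_funD => //; apply: measurable_funM => //.
  apply: measurable_sum => i; apply: measurableT_comp => //.
  exact: measurable_funB.
have := mh measurableT `]-oo, c[%classic (measurable_itv _).
by congr measurable; apply/seteqP; split=> w; rewrite /= in_itv.
Qed.

Lemma orthonormal_rows_pivot (R : comNzRingType) m n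
    (C : 'M[R]_(1 + m, 1 + n)) :
  C *m C^T = 1%:M -> row 0 C = delta_mx 0 0 ->
  exists2 D : 'M[R]_(m, n), D *m D^T = 1%:M & C = block_mx 1%:M 0 0 D.
Proof.
move=> C1 C0.
have C0j j : C 0 j = (j == 0)%:R by move/rowP: C0 => /(_ j); rewrite !mxE eqxx.
have Ci0 i : C i 0 = (i == 0)%:R.
  move/matrixP: C1 => /(_ i 0); rewrite mxE (bigD1 0)//= big1 => [|j j0].
    by rewrite addr0 !mxE C0j eqxx mulr1.
  by rewrite mxE C0j (negbTE j0) mulr0.
have l0 k : lshift k 0 = 0 :> 'I_(1 + k) by exact: val_inj.
have r0 k (i : 'I_k) : (rshift 1 i == 0 :> 'I_(1 + k)) = false.
  exact/negbTE/eqP.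
have CE : C = block_mx 1%:M 0 0 (drsubmx C).
  rewrite -{1}(submxK C); congr block_mx;
    apply/matrixP => i j; rewrite !mxE ?ord1 ?l0.
  - by rewrite C0j.
  - by rewrite C0j r0.
  - by rewrite Ci0 r0.
exists (drsubmx C) => //; move: C1; rewrite CE tr_block_mx mulmx_block.
rewrite !trmx0 !mul0mx !mulmx0 !add0r block_mxKdr => C1.
have /(congr1 drsubmx) := C1; rewrite block_mxKdr => ->.
by rewrite scalar_mx_block block_mxKdr.
Qed.

(** The orthogonal matrix completing the first row of [A] moves that row to the
    first basis vector; orthonormality of the rows then splits off a block of
    size one, and the rest follows by induction. *)
Theorem gaussian_preserving_isometry d (T : measurableType d) (R : realType)
    (P : probability T R) m n (A : 'M[R]_(m, n)) :
  A *m A^T = 1%:M -> gaussian_preserving P A.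
Proof.
have zero_rows k (B : 'M[R]_(0, k)) : gaussian_preserving P B.
  move=> E Z [mE mZ EZ]; split=> // [[//]|C mC].
  rewrite big_ord0 mule1; congr (P _).
  by apply/seteqP; split=> w /=; [case|split=> // -[]].
elim: m n A => [|m IH] [|n] A A1.
- exact: zero_rows.
- exact: zero_rows.
- move/matrixP: A1 => /(_ 0 0); rewrite !mxE big_ord0 => /eqP.
  by rewrite eq_sym oner_eq0.
have a1 : row 0 A *m (row 0 A)^T = 1%:M.
  apply/matrixP => i j; rewrite !ord1; move/matrixP: A1 => /(_ 0 0).
  rewrite [LHS]mxE [RHS]mxE eqxx => A1'; rewrite [RHS]mxE eqxx -A1' mxE.
  by apply: eq_bigr => k _; rewrite !mxE.
have [V [V1 Va gV]] := gaussian_preserving_completion P a1.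
pose C : 'M[R]_(1 + m, 1 + n) := A *m V^T.
have VV := mulmx1C V1.
have C1 : C *m C^T = 1%:M.
  by rewrite /C trmx_mul trmxK mulmxA -(mulmxA A) VV mulmx1.
have C0 : row 0 C = delta_mx 0 0 by rewrite /C row_mul -Va -row_mul V1 row1.
have [D D1 CE] := orthonormal_rows_pivot C1 C0.
have AE : A = C *m V by rewrite /C -mulmxA VV mulmx1.
have gC : gaussian_preserving P C.
  rewrite CE; apply: gaussian_preserving_block; last exact: IH.
  exact: gaussian_preserving1.
by rewrite AE; exact: gaussian_preserving_comp gC gV.
Qed.

(** Column vectors carry no sigma-algebra, tuples carry the product one; the
    measurability of functions of a column is expressed through tuples. *)
Definition tuple_col (R : realType) n (t : n.-tuple R) : 'cV[R]_n :=
  \col_i tnth t i.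

(** Both vectors give the same mass to rectangles, which generate the product
    sigma-algebra, so any measurable function has the same law at either. *)
Lemma gaussian_law_unique (R : realType) d d' (T : measurableType d)
    (T' : measurableType d') (P : probability T R) (P' : probability T' R) n
    (Z : T -> 'cV[R]_n) (Z' : T' -> 'cV[R]_n) (f : 'cV[R]_n -> R) :
  gaussian_on P setT Z -> gaussian_on P' setT Z' ->
  measurable_fun setT (f \o @tuple_col R n) ->
  same_law P P' (f \o Z) (f \o Z').
Proof.
move=> [_ mZ gZ] [_ mZ' gZ'] mf.
pose W w : n.-tuple R := [tuple Z w i 0 | i < n].
pose W' w : n.-tuple R := [tuple Z' w i 0 | i < n].
have mW : measurable_fun setT W.
  apply/measurable_fun_tnthP => i.
  rewrite (_ : _ \o W = fun w => Z w i 0); first exact: mZ.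
  by apply/funext => w; rewrite /= tnth_mktuple.
have mW' : measurable_fun setT W'.
  apply/measurable_fun_tnthP => i.
  rewrite (_ : _ \o W' = fun w => Z' w i 0); first exact: mZ'.
  by apply/funext => w; rewrite /= tnth_mktuple.
have fW : f \o Z = (f \o @tuple_col R n) \o W.
  apply/funext => w /=; congr f; apply/colP => i.
  by rewrite mxE tnth_mktuple.
have fW' : f \o Z' = (f \o @tuple_col R n) \o W'.
  apply/funext => w /=; congr f; apply/colP => i.
  by rewrite mxE tnth_mktuple.
rewrite fW fW'; split; [exact: measurableT_comp|exact: measurableT_comp|].
move=> B mB.
pose m1 : {measure set (n.-tuple R) -> \bar R} := pushforward P W.
pose m2 : {measure set (n.-tuple R) -> \bar R} := pushforward P' W'.
pose G : set (set (n.-tuple R)) :=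
  [set [set t | forall i, A i (tnth t i)] |
    A in [set A | forall i, measurable (A i)]].
have GM : G `<=` measurable.
  move=> _ [A mA <-].
  apply: (measurable_cylinder (Z := fun t i => tnth t i)) => // i.
  exact: measurable_tnth.
suff E (D : set (n.-tuple R)) : measurable D -> P (W @^-1` D) = P' (W' @^-1` D).
  have := E ((f \o @tuple_col R n) @^-1` B); apply.
  by rewrite -[X in measurable X]setTI; exact: mf.
move=> mD.
apply: (g_sigma_algebra_measure_unique G GM (fun=> setT) _ _ (m1 mW) (m2 mW')).
- by move=> _; exists (fun=> setT) => //; apply/seteqP; split.
- exact: bigcup_const.
- move=> _ _ [A mA <-] [C mC <-]; exists (fun i => A i `&` C i).
    by move=> i; exact: measurableI.
  apply/seteqP; split=> t /=; last by move=> [HA HC] i; split.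
  by move=> H; split=> i; have [] := H i.
- move=> _ [A mA <-]; rewrite /m1 /m2 /= /pushforward.
  have := gZ A mA; have := gZ' A mA.
  rewrite !setTI !probability_setT => E' E.
  transitivity (P [set w | forall i, A i (Z w i 0)]).
    congr (P _); apply/funext => w; apply/propext => /=.
    by split=> H i; have := H i; rewrite tnth_mktuple.
  rewrite E -E'; congr (P' _); apply/funext => w; apply/propext => /=.
  by split=> H i; have := H i; rewrite tnth_mktuple.
- move=> _; rewrite /m1 /= /pushforward preimage_setT.
  by rewrite probability_setT ltry.
- move: mD; apply: smallest_sub; first exact: smallest_sigma_algebra.
  rewrite -bigcup_seq/=; apply: bigcup_sub => i _ _ [A mA <-].
  apply: sub_sigma_algebra; exists (fun j => if j == i then A else setT).
    by move=> j /=; case: ifP.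
  apply/seteqP; split=> t /=; first by move=> /(_ i); rewrite eqxx.
  by move=> [_ At] j; case: eqP => [->|].
Qed.

(** * Gaussian symmetric matrices *)

Lemma sym_basis_sym (R : realType) k (u : sym_index k) :
  (sym_basis R k u)^T = sym_basis R k u.
Proof.
rewrite /sym_basis; case: (val u) => i j; case: ifP => _.
  by rewrite trmx_delta.
by rewrite linearZ/= linearD/= !trmx_delta addrC.
Qed.

(** Only the entries on and above the diagonal are read, where the basis element
    of index [u] has the single nonzero entry at [u]. *)
Lemma sym_basisE (R : realType) k (u v : sym_index k) :
  sym_basis R k u (val v).1 (val v).2 =
  if u == v then (if (val v).1 == (val v).2 then 1 else (Num.sqrt 2)^-1) else 0.
Proof.
rewrite -val_eqE; case: u v => -[i j] /= ij [[a b] /= ab].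
rewrite /sym_basis/= xpair_eqE; have [<-{j ij}|ij'] := eqVneq i j.
  rewrite mxE eq_sym; case: eqVneq => [->|]//=.
  by rewrite [b == a]eq_sym; case: eqVneq.
have ij2 : (i < j)%N by rewrite ltn_neqAle ij' ij.
rewrite !mxE ![_ == i]eq_sym ![_ == j]eq_sym.
have -> : (j == a) && (i == b) = false.
  apply/negbTE/negP => /andP[/eqP ja /eqP ib].
  by move: ab ij2; rewrite -ja -ib; lia.
rewrite addr0; case: eqVneq => [ia|]; case: eqVneq => [jb|]; rewrite ?mulr0//=.
by rewrite mulr1 -ia -jb (negbTE ij').
Qed.

Lemma frob_dot_delta (R : realType) k (i j : 'I_k) (M : 'M[R]_k) :
  frob_dot (delta_mx i j) M = M i j.
Proof.
rewrite frob_dotE (bigD1 i)//= (bigD1 j)//= !mxE !eqxx mul1r.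
rewrite big1 => [|l /negbTE lj]; last by rewrite mxE lj andbF mul0r.
rewrite big1 ?addr0// => l /negbTE li; apply: big1 => t _.
by rewrite mxE li mul0r.
Qed.

Lemma frob_dot_sym_basis (R : realType) k (u : sym_index k) (M : 'M[R]_k) :
  M^T = M -> frob_dot (sym_basis R k u) M =
  (if (val u).1 == (val u).2 then 1 else Num.sqrt 2) * M (val u).1 (val u).2.
Proof.
move=> sM; rewrite /sym_basis; case: (val u) => i j /=.
case: eqVneq => [<-|_]; first by rewrite frob_dot_delta mul1r.
have Mji : M j i = M i j by rewrite -{1}sM mxE.
rewrite frob_dotZl frob_dotDl !frob_dot_delta Mji.
rewrite (_ : M i j + M i j = 2 * M i j); last by ring.
rewrite mulrA; congr (_ * _).
by rewrite -[X in _ * X](@sqr_sqrtr _ 2)// expr2 mulKf// gt_eqF// sqrtr_gt0.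
Qed.

Lemma sqrt2_neq0 (R : realType) : Num.sqrt 2 != 0 :> R.
Proof. by rewrite gt_eqF// sqrtr_gt0. Qed.

Lemma sym_basis_orthonormal (R : realType) k (u v : sym_index k) :
  frob_dot (sym_basis R k u) (sym_basis R k v) = (u == v)%:R.
Proof.
rewrite frob_dot_sym_basis ?sym_basis_sym// sym_basisE [v == u]eq_sym.
case: (u == v); last by rewrite mulr0.
by case: ifP => _; rewrite ?mulr1// divff// sqrt2_neq0.
Qed.

Lemma frob_dot_suml (R : realType) k (I : finType) (F : I -> 'M[R]_k)
    (N : 'M[R]_k) :
  frob_dot (\sum_i F i) N = \sum_i frob_dot (F i) N.
Proof.
by rewrite /frob_dot linear_sum/= mulmx_suml linear_sum.
Qed.

Lemma sym_basis_expansion (R : realType) k (M : 'M[R]_k) : M^T = M ->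
  M = \sum_u frob_dot (sym_basis R k u) M *: sym_basis R k u.
Proof.
move=> sM; set N := \sum_u _.
have sN : N^T = N.
  rewrite /N linear_sum/=; apply: eq_bigr => u _.
  by rewrite linearZ/= sym_basis_sym.
have upper (v : sym_index k) : M (val v).1 (val v).2 = N (val v).1 (val v).2.
  rewrite /N summxE (bigD1 v)//= big1 => [|u uv]; last first.
    by rewrite mxE sym_basisE (negbTE uv) mulr0.
  rewrite mxE sym_basisE eqxx addr0 frob_dot_sym_basis//.
  case: ifP => _; first by rewrite mul1r mulr1.
  by rewrite mulrAC divff ?mul1r// sqrt2_neq0.
apply/matrixP => i j; have [ij|/ltnW ji] := leqP i j.
  exact: (upper (exist _ (i, j) ij)).
rewrite -[M]sM -[N]sN !mxE.
exact: (upper (exist _ (j, i) ji)).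
Qed.

Lemma sym_basis_parseval (R : realType) k (M N : 'M[R]_k) :
  M^T = M -> N^T = N ->
  frob_dot M N =
  \sum_u frob_dot (sym_basis R k u) M * frob_dot (sym_basis R k u) N.
Proof.
move=> sM sN; rewrite {1}(sym_basis_expansion sM) frob_dot_suml.
by apply: eq_bigr => u _; rewrite frob_dotZl.
Qed.

(** Flattening the index type to an ordinal makes orthonormal changes of
    coordinates available as matrices. *)
Definition sym_of_coord (R : realType) k (z : 'cV[R]_#|{: sym_index k}|) :
    'M[R]_k :=
  \sum_i z i 0 *: sym_basis R k (enum_val i).

Lemma sym_of_coord_sym (R : realType) k (z : 'cV[R]_#|{: sym_index k}|) :
  (sym_of_coord z)^T = sym_of_coord z.
Proof.
rewrite /sym_of_coord linear_sum/=; apply: eq_bigr => i _.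
by rewrite linearZ/= sym_basis_sym.
Qed.

(** The adjoint of the compression by an isometry [U] is [M |-> U *m M *m U^T],
    which preserves the Frobenius product; hence the matrix of the compression
    in the orthonormal bases has orthonormal rows. *)
Lemma compression_coord (R : realType) k n (U : 'M[R]_(k, n)) :
  U^T *m U = 1%:M ->
  exists2 A : 'M[R]_(#|{: sym_index n}|, #|{: sym_index k}|),
    A *m A^T = 1%:M &
    forall z, U^T *m sym_of_coord z *m U = sym_of_coord (A *m z).
Proof.
move=> U1.
pose A : 'M[R]_(#|{: sym_index n}|, #|{: sym_index k}|) :=
  \matrix_(v, u) frob_dot (sym_basis R n (enum_val v))
    (U^T *m sym_basis R k (enum_val u) *m U).
have adj M N : frob_dot M (U^T *m N *m U) = frob_dot (U *m M *m U^T) N.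
  by rewrite /frob_dot !trmx_mul trmxK !mulmxA [LHS]mxtrace_mulC !mulmxA.
exists A => [|z]; last first.
  have sG : (U^T *m sym_of_coord z *m U)^T = U^T *m sym_of_coord z *m U.
    by rewrite !trmx_mul trmxK sym_of_coord_sym mulmxA.
  rewrite [LHS](sym_basis_expansion sG) big_enum_val/=.
  apply: eq_bigr => v _; congr (_ *: _).
  rewrite adj frob_dotC {1}/sym_of_coord frob_dot_suml mxE.
  by apply: eq_bigr => u _; rewrite frob_dotZl mxE frob_dotC -adj mulrC.
apply/matrixP => v v'; rewrite !mxE.
transitivity (frob_dot (U *m sym_basis R n (enum_val v) *m U^T)
    (U *m sym_basis R n (enum_val v') *m U^T)).
  rewrite sym_basis_parseval; first last.
  - by rewrite !trmx_mul trmxK sym_basis_sym mulmxA.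
  - by rewrite !trmx_mul trmxK sym_basis_sym mulmxA.
  rewrite [RHS]big_enum_val/=; apply: eq_bigr => u _; rewrite !mxE !adj.
  by rewrite -!(frob_dotC (sym_basis R k _)).
rewrite -adj !mulmxA U1 mul1mx -mulmxA U1 mulmx1 sym_basis_orthonormal.
by rewrite (inj_eq enum_val_inj).
Qed.

Lemma std_gaussian_coord d (T : measurableType d) (R : realType)
    (P : probability T R) k (Y : T -> 'M[R]_k) :
  std_gaussian P Y <->
  exists2 Z : T -> 'cV[R]_#|{: sym_index k}|,
    gaussian_on P setT Z & forall w, Y w = sym_of_coord (Z w).
Proof.
split=> [[Z [indZ Zn YE]]|[Z gZ YE]].
  exists (fun w => \col_i Z (enum_val i) w); last first.
    move=> w; rewrite YE /sym_of_coord big_enum_val/=.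
    by apply: eq_bigr => i _; rewrite mxE.
  split=> // [i|B mB].
    under eq_fun do rewrite mxE.
    exact: measurable_funP.
  rewrite setTI probability_setT mul1e.
  have := indZ [set u : sym_index k | true]%SET (fun u => B (enum_rank u))
    (fun u => mB _).
  rewrite (_ : \bigcap_(i in _) _ =
    [set w | forall i, B i ((\col_i Z (enum_val i) w) i 0)]); last first.
    apply/seteqP; split=> w /= H.
      move=> i; have := H (enum_val i); rewrite mxE enum_valK.
      by apply; rewrite /= inE.
    by move=> u _ /=; have := H (enum_rank u); rewrite mxE enum_rankK.
  move=> ->; rewrite (eq_bigl xpredT); last by move=> u; rewrite inE.
  rewrite big_enum_val/=; apply: eq_bigr => i _.
  by rewrite enum_valK; exact: Zn.
have [_ mZ EZ] := gZ.
pose Zu (u : sym_index k) : {RV P >-> R} :=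
  HB.pack (fun w => Z w (enum_rank u) 0)
    (isMeasurableFun.Build _ _ _ _ _ (mZ (enum_rank u))).
have ind (J : {set sym_index k}) (B : sym_index k -> set R) :
    (forall u, measurable (B u)) ->
    P (\bigcap_(i in [set` J]) (Zu i @^-1` B i)) =
    (\prod_(i in J) normal_prob 0 1 (B i))%E.
  move=> mB; pose C (i : 'I_#|{: sym_index k}|) :=
    if enum_val i \in J then B (enum_val i) else setT.
  have mC i : measurable (C i) by rewrite /C; case: ifP.
  have := EZ C mC; rewrite setTI probability_setT mul1e.
  rewrite (_ : [set w | _] =
    \bigcap_(i in [set` J]) (Zu i @^-1` B i)); last first.
    apply/seteqP; split=> w /= H.
      by move=> u uJ /=; have := H (enum_rank u); rewrite /C enum_rankK uJ.
    move=> i; rewrite /C; case: ifPn => // iJ.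
    by have := H _ iJ; rewrite /= enum_valK.
  move=> ->; rewrite [RHS]big_mkcond [RHS]big_enum_val/=; apply: eq_bigr => i _.
  by rewrite /C; case: ifP => // _; exact: probability_setT.
exists Zu; split.
- move=> J B mB; rewrite ind//; apply: eq_bigr => u _.
  have := ind [set u]%SET (fun=> B u) (fun=> mB u).
  rewrite big_set1 => <-; congr (P _); apply/seteqP; split=> w /= H.
    by apply: H; rewrite /= inE.
  by move=> v /=; rewrite inE => /eqP ->.
- move=> u B mB; have := ind [set u]%SET (fun=> B) (fun=> mB).
  rewrite big_set1 => <-; congr (P _); apply/seteqP; split=> w /= H.
    by move=> v /=; rewrite inE => /eqP ->.
  by apply: H; rewrite /= inE.
- move=> w; rewrite YE /sym_of_coord [RHS]big_enum_val/=.
  by apply: eq_bigr => i _; rewrite enum_valK.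
Qed.

Lemma std_gaussian_compression d (T : measurableType d) (R : realType)
    (P : probability T R) k n (Y : T -> 'M[R]_k) (U : 'M[R]_(k, n)) :
  U^T *m U = 1%:M -> std_gaussian P Y ->
  std_gaussian P (fun w => U^T *m Y w *m U).
Proof.
move=> U1 /std_gaussian_coord[Z gZ YE].
have [A A1 AE] := compression_coord U1.
apply/std_gaussian_coord; exists (fun w => A *m Z w).
  exact: gaussian_preserving_isometry.
by move=> w; rewrite YE AE.
Qed.

Lemma std_gaussian_sym d (T : measurableType d) (R : realType)
    (P : probability T R) k (Y : T -> 'M[R]_k) w :
  std_gaussian P Y -> (Y w)^T = Y w.
Proof. by move=> /std_gaussian_coord[Z _ ->]; exact: sym_of_coord_sym. Qed.

(** * Measurability and laws of the statistics *)

Lemma frob_dot_cauchy_schwarz (R : realType) k (A B : 'M[R]_k) :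
  frob_dot A B <= frob_norm A * frob_norm B.
Proof.
have [->|B0] := eqVneq B 0.
  by rewrite frob_dotC /frob_dot trmx0 mul0mx mxtrace0 mulr_ge0// sqrtr_ge0.
have b0 := frob_dot_gt0 B0.
rewrite /frob_norm -sqrtrM ?frob_dot_ge0//.
apply: (le_trans (ler_norm _)); rewrite -sqrtr_sqr ler_wsqrtr//.
have := frob_dot_ge0 (frob_dot B B *: A - frob_dot A B *: B).
rewrite frob_dotDl -scaleNr !frob_dotZl ![frob_dot _ (_ + _)]frob_dotC.
rewrite !frob_dotDl !frob_dotZl (frob_dotC B A).
set a := frob_dot A A; set b := frob_dot B B in b0 *; set c := frob_dot A B.
move=> h; rewrite -(ler_pM2l b0).
nra.
Qed.

Lemma frob_norm_triangle (R : realType) k (A B : 'M[R]_k) :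
  frob_norm (A + B) <= frob_norm A + frob_norm B.
Proof.
have nn : 0 <= frob_norm A + frob_norm B by rewrite addr_ge0// sqrtr_ge0.
rewrite -[leRHS]ger0_norm// -sqrtr_sqr {1}/frob_norm ler_wsqrtr//.
rewrite sqrrD /frob_norm !sqr_sqrtr ?frob_dot_ge0// -!/(frob_norm _).
rewrite frob_dotDl ![frob_dot _ (_ + _)]frob_dotC !frob_dotDl (frob_dotC B A).
by have := frob_dot_cauchy_schwarz A B; lra.
Qed.

Lemma frob_norm_sum (R : realType) k (I : finType) (F : I -> 'M[R]_k) :
  frob_norm (\sum_i F i) <= \sum_i frob_norm (F i).
Proof.
elim/big_ind2 : _ => [|x1 x2 y1 y2 h1 h2|//].
  by rewrite /frob_norm /frob_dot mulmx0 mxtrace0 sqrtr0.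
exact: le_trans (frob_norm_triangle _ _) (lerD h1 h2).
Qed.

Lemma frob_dist_lipschitz (R : realType) k (K : set 'M[R]_k) (X Y : 'M[R]_k) :
  K !=set0 -> frob_dist X K <= frob_dist Y K + frob_norm (X - Y).
Proof.
move=> [Z0 KZ0]; rewrite -lerBlDr; apply: lb_le_inf.
  by exists (frob_norm (Y - Z0)), Z0.
move=> _ [Z KZ <-]; rewrite lerBlDr.
apply: (@le_trans _ _ (frob_norm (X - Z))).
  apply: ge_inf; last by exists Z.
  by exists 0 => _ [W _ <-]; exact: sqrtr_ge0.
rewrite (_ : X - Z = (Y - Z) + (X - Y)); first exact: frob_norm_triangle.
by rewrite [RHS]addrC subrKA.
Qed.

Lemma sym_of_coord_norm (R : realType) k (z z' : 'cV[R]_#|{: sym_index k}|) :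
  frob_norm (sym_of_coord z - sym_of_coord z') <= \sum_i `|z i 0 - z' i 0|.
Proof.
rewrite /sym_of_coord -sumrB.
apply: (le_trans (frob_norm_sum _)); apply: ler_sum => i _.
rewrite -scalerBl /frob_norm frob_dotZl frob_dotC frob_dotZl.
by rewrite sym_basis_orthonormal eqxx mulr1 -expr2 sqrtr_sqr.
Qed.

Lemma rank_cone0 (R : realType) m k : rank_cone R m k 0.
Proof.
split; last by rewrite mxrank0.
by split=> [|x]; rewrite /symmx/= ?trmx0// mulmx0 mul0mx mxE.
Qed.

Lemma measurable_tuple_col (R : realType) n (i : 'I_n) :
  measurable_fun setT (fun t : n.-tuple R => tuple_col t i 0).
Proof. by under eq_fun do rewrite mxE; exact: measurable_tnth. Qed.

(** The statistic is a difference of squared distances, and distances are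
    Lipschitz functions of the coordinates. *)
Lemma measurable_transition_coord (R : realType) k m (C : 'M[R]_k) :
  measurable_fun setT (fun t : #|{: sym_index k}|.-tuple R =>
    transition_stat m C (sym_of_coord (tuple_col t))).
Proof.
have dist_m n : measurable_fun setT (fun t : #|{: sym_index k}|.-tuple R =>
    frob_dist (sym_of_coord (tuple_col t) + C) (rank_cone R n k)).
  apply: (@measurable_lipschitz _ _ _ _ (@tuple_col R _)
    (fun z => frob_dist (sym_of_coord z + C) (rank_cone R n k)) 1).
    exact: measurable_tuple_col.
  move=> x y; rewrite mul1r.
  apply: (le_trans (@frob_dist_lipschitz _ _ _ _ (sym_of_coord y + C) _)).
    by exists 0; exact: rank_cone0.
  by rewrite lerD2l opprD addrACA subrr addr0; exact: sym_of_coord_norm.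
rewrite /transition_stat -rank_coneT.
by apply: measurable_funB; apply: measurable_funX.
Qed.

Lemma transition_stat_law (R : realType) d d' (T : measurableType d)
    (T' : measurableType d') (P : probability T R) (P' : probability T' R) k m
    (C : 'M[R]_k) (Y : T -> 'M[R]_k) (Y' : T' -> 'M[R]_k) :
  std_gaussian P Y -> std_gaussian P' Y' ->
  same_law P P' (fun w => transition_stat m C (Y w))
                (fun w => transition_stat m C (Y' w)).
Proof.
move=> /std_gaussian_coord[Z gZ YE] /std_gaussian_coord[Z' gZ' YE'].
have := gaussian_law_unique
  (f := fun z => transition_stat m C (sym_of_coord z)) gZ gZ'.
rewrite (_ : (fun w => transition_stat m C (Y w)) =
  (fun z => transition_stat m C (sym_of_coord z)) \o Z); last first.
  by apply/funext => w /=; rewrite YE.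
rewrite (_ : (fun w => transition_stat m C (Y' w)) =
  (fun z => transition_stat m C (sym_of_coord z)) \o Z'); last first.
  by apply/funext => w /=; rewrite YE'.
by apply; exact: measurable_transition_coord.
Qed.

Lemma transition_stat_measurable (R : realType) d (T : measurableType d)
    (P : probability T R) k m (C : 'M[R]_k) (Y : T -> 'M[R]_k) :
  std_gaussian P Y -> measurable_fun setT (fun w => transition_stat m C (Y w)).
Proof. by move=> gY; have [] := transition_stat_law m C gY gY. Qed.

(** The infimum is attained: the distribution function tends to [0] and [1] at
    the infinities, so the infimum is over a nonempty set bounded below, and
    right-continuity passes the inequality to the limit. *)
Lemma upper_crit_tail (R : realType) d (T : measurableType d)
    (P : probability T R) (X : T -> R) (alpha : R) :
  measurable_fun setT X -> 0 < alpha < 1 ->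
  (P [set w | (upper_crit (distr_fun P X) alpha < X w)%R] <= alpha%:E)%E.
Proof.
move=> mX /andP[a0 a1].
pose X' : {RV P >-> R} := HB.pack X (isMeasurableFun.Build _ _ _ _ _ mX).
have FE c : distr_fun P X c = cdf X' c.
  by rewrite /distr_fun /cdf /distribution /pushforward; congr (P _).
pose S := [set c | ((1 - alpha)%:E <= cdf X' c)%E].
have upper c x : S c -> c <= x -> S x.
  by move=> Sc cx; apply: (le_trans Sc); exact: cdf_nondecreasing.
have S0 : S !=set0.
  apply/set0P/eqP => S0.
  have : (1 <= (1 - alpha)%:E :> \bar R)%E.
    apply: (cvge_le _ (cvg_cdfy1 X')).
    near=> x; rewrite leNgt; apply/negP => /ltW Sx.
    by have : S x by []; rewrite S0.
  by rewrite lee_fin; lra.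
have Slb : has_lbound S.
  apply: contrapT => nlb.
  have allS x : S x.
    apply: contrapT => nSx; apply: nlb; exists x => c Sc.
    by rewrite leNgt; apply/negP => /ltW cx; apply: nSx; exact: upper Sc cx.
  have : ((1 - alpha)%:E <= 0 :> \bar R)%E.
    apply: (cvge_ge _ (cvg_cdfNy0 X')).
    by near=> x; exact: allS.
  by rewrite lee_fin; lra.
have qE : upper_crit (distr_fun P X) alpha = inf S.
  by rewrite /upper_crit; congr inf; apply/funext => c; rewrite /= FE.
rewrite qE; set q := inf S.
have Sq : S q.
  apply: (cvge_ge _ (@cdf_right_continuous _ _ _ _ X' q)).
  near=> x; have qx : q < x by near: x; exact: nbhs_right_gt.
  have [c Sc cx] : exists2 c, S c & c < x by move: qx => /(inf_lt S0).
  exact: upper Sc (ltW cx).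
have mle : measurable [set w | X w <= q].
  have := mX measurableT `]-oo, q]%classic (measurable_itv _).
  by congr measurable; apply/seteqP; split=> w; rewrite /= in_itv/=; tauto.
have -> : [set w | q < X w] = ~` [set w | X w <= q].
  by apply/seteqP; split=> w /=; rewrite ltNge => /negP.
rewrite probability_setC//.
move: Sq; rewrite /S/= -FE /distr_fun.
have fin := fin_num_measure P _ mle.
rewrite -(fineK fin) -EFinB !lee_fin; lra.
Unshelve. all: by end_near.
Qed.

(** * Couplings and critical values *)

(** Compressing to [p] directions on which the form of [C] vanishes removes [C]
    and uses up the whole rank bound [m]. *)
Lemma transition_stat_le_pos_eig (R : realType) k m p (C Y : 'M[R]_k)
    (U : 'M[R]_(k, p)) :
  (m + p = k)%N -> U^T *m U = 1%:M -> U^T *m C *m U = 0 ->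
  Y^T = Y -> C^T = C ->
  transition_stat m C Y <= pos_eig_stat (U^T *m Y *m U).
Proof.
move=> mpk U1 UC sY sC; rewrite pos_eig_statE; last first.
  by rewrite !trmx_mul trmxK sY mulmxA.
have := transition_stat_compression 0 U1 sY sC.
by rewrite UC (_ : (0 + (k - p) = m)%N)// -mpk addnK.
Qed.

Lemma same_law_gt (R : realType) d d' (T : measurableType d)
    (T' : measurableType d') (P : probability T R) (P' : probability T' R)
    (X : T -> R) (X' : T' -> R) c :
  same_law P P' X X' -> P [set w | c < X w] = P' [set w | c < X' w].
Proof.
move=> [_ _ XX']; have := XX' `]c, +oo[%classic (measurable_itv _).
rewrite /pushforward => E.
transitivity (P (X @^-1` `]c, +oo[%classic)).
  by congr (P _); apply/seteqP; split=> w; rewrite /= in_itv/= andbT.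
rewrite E.
by congr (P' _); apply/seteqP; split=> w; rewrite /= in_itv/= andbT.
Qed.

Theorem theorem3p10 (R : realType) (q r : nat) (hrq : (r < q)%N)
    (P : 'I_r.+1 -> 'M[R]_q)
    (S : forall s : 'I_r.+1, 'M[R]_q -> 'End('M[R]_(q - s)))
    (hP : forall s : 'I_r.+1, orth_projector (q - s) (P s))
    (hS : forall s : 'I_r.+1, selfadjoint_pd (S s (P s)))
    (hiso : forall s : 'I_r.+1, isotropic (S s (P s)))
    (d : 'I_r.+1 -> measure_display)
    (T : forall s : 'I_r.+1, measurableType (d s))
    (mu : forall s : 'I_r.+1, probability (T s) R)
    (Y : forall s : 'I_r.+1, T s -> 'M[R]_(q - s))
    (hY : forall s : 'I_r.+1, std_gaussian (mu s) (Y s)) :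
  let p := (q - r)%N in
  let Delta (s : 'I_r.+1) (w : T s) : R :=
    stratum_stat (r - s) (S s (P s)) (Y s w) in
  [/\
    (* the law of Delta_{s,r}(P_s) does not depend on P_s *)
    forall (s : 'I_r.+1) (P' : 'M[R]_q), orth_projector (q - s) P' ->
      selfadjoint_pd (S s P') -> isotropic (S s P') ->
      same_law (mu s) (mu s) (Delta s)
        (fun w => stratum_stat (r - s) (S s P') (Y s w)),
    (* (i) *)
    exists (d0 : measure_display) (Omega : measurableType d0)
        (Pr : probability Omega R) (D : 'I_r.+1 -> {RV Pr >-> R}),
      (forall s : 'I_r.+1, same_law Pr (mu s) (D s) (Delta s)) /\
      {ae Pr, forall w, forall s t : 'I_r.+1, (s <= t)%N -> D s w <= D t w},
    (* (ii) *)
    forall (s : 'I_r.+1) (C : 'M[R]_(q - s)), rank_cone R (r - s) (q - s) C ->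
      exists (d0 : measure_display) (Omega : measurableType d0)
        (Pr : probability Omega R) (Y' : Omega -> 'M[R]_(q - s))
        (G : Omega -> 'M[R]_p),
        [/\ std_gaussian Pr Y', std_gaussian Pr G
          & {ae Pr, forall w,
              transition_stat (r - s) C (Y' w) <= pos_eig_stat (G w)}],
    (* (iii), law of T_p *)
    forall (d0 : measure_display) (Omega : measurableType d0)
      (Pr : probability Omega R) (G : Omega -> 'M[R]_p), std_gaussian Pr G ->
      same_law Pr (mu ord_max) (fun w => pos_eig_stat (G w)) (Delta ord_max)
    (* (iii), critical value *)
  & forall alpha : R, 0 < alpha < 1 ->
      let q_alpha :=
        upper_crit (distr_fun (mu ord_max) (Delta ord_max)) alpha in
      forall s : 'I_r.+1,
        (mu s [set w | (q_alpha < Delta s w)%R] <= alpha%:E)%E /\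
        forall C : 'M[R]_(q - s), rank_cone R (r - s) (q - s) C ->
          (mu s [set w | (q_alpha < transition_stat (r - s) C (Y s w))%R]
             <= alpha%:E)%E].
Proof.
move=> p Delta.
have k0 (s : 'I_r.+1) : (0 < q - s)%N by have := ltn_ord s; lia.
have DeltaE (s : 'I_r.+1) w : Delta s w = transition_stat (r - s) 0 (Y s w).
  exact: stratum_stat_isotropic.
have mpk (s : 'I_r.+1) : (r - s + p = q - s)%N.
  by have := ltn_ord s; rewrite /p; lia.
have law_top d0 (Omega : measurableType d0) (Pr : probability Omega R)
    (G : Omega -> 'M[R]_p) : std_gaussian Pr G ->
    same_law Pr (mu ord_max) (fun w => pos_eig_stat (G w)) (Delta ord_max).
  move=> gG; have := transition_stat_law 0 (0 : 'M[R]_p) gG (hY ord_max).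
  rewrite (_ : (fun w => transition_stat 0 0 (G w)) =
    (fun w => pos_eig_stat (G w))).
    rewrite (_ : (fun w => _) = Delta ord_max)//.
    by apply/funext => w; rewrite DeltaE /= subnn.
  apply/funext => w; rewrite pos_eig_statE//.
  exact: std_gaussian_sym gG.
split.
- move=> s P' hP' hS' hiso'.
  rewrite (_ : (fun w => stratum_stat _ _ _) = Delta s); last first.
    by apply/funext => w; rewrite DeltaE stratum_stat_isotropic.
  rewrite (_ : Delta s = fun w => transition_stat (r - s) 0 (Y s w)).
    exact: transition_stat_law.
  by apply/funext => w; exact: DeltaE.
- (* the coupling: nested principal submatrices of the largest matrix *)
  pose U (s : 'I_r.+1) : 'M[R]_(q - ord0 (n' := r), q - s) := pid_mx (q - s).
  have U1 s : (U s)^T *m U s = 1%:M.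
    rewrite /U tr_pid_mx mul_pid_mx minnn (_ : minn _ _ = q - s)%N ?pid_mx_1//.
    by apply/minn_idPr; rewrite /= subn0 leq_subr.
  have UV (s t : 'I_r.+1) : (s <= t)%N ->
      U t = U s *m (pid_mx (q - t) : 'M[R]_(q - s, q - t)).
    by move=> st; rewrite /U mul_pid_mx; congr pid_mx; lia.
  pose YU s w := (U s)^T *m Y ord0 w *m U s.
  have gYU s : std_gaussian (mu ord0) (YU s) by exact: std_gaussian_compression.
  have mD (s : 'I_r.+1) := transition_stat_measurable (r - s) 0 (gYU s).
  pose D (s : 'I_r.+1) : {RV (mu ord0) >-> R} :=
    HB.pack (fun w => transition_stat (r - s) 0 (YU s w))
      (isMeasurableFun.Build _ _ _ _ _ (mD s)).
  exists (d ord0), (T ord0), (mu ord0), D; split.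
    move=> s.
    rewrite (_ : Delta s = fun w => transition_stat (r - s) 0 (Y s w)).
      exact: transition_stat_law.
    by apply/funext => w; exact: DeltaE.
  apply: aeW => w s t st.
  have V1 : (pid_mx (q - t) : 'M[R]_(q - s, q - t))^T *m pid_mx (q - t) = 1%:M.
    rewrite tr_pid_mx mul_pid_mx minnn (_ : minn _ _ = q - t)%N ?pid_mx_1//.
    by lia.
  have sYU : (YU s w)^T = YU s w by exact: std_gaussian_sym (gYU s).
  have := transition_stat_compression (r - t) V1 sYU (trmx0 _ _ _).
  rewrite mulmx0 mul0mx.
  rewrite (_ : (r - t + _ = r - s)%N); last first.
    by have := ltn_ord t; have := ltn_ord s; lia.
  rewrite (_ : _ *m YU s w *m _ = YU t w)//.
  by rewrite /YU (UV _ _ st) trmx_mul !mulmxA.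
- move=> s C hC; have [U [U1 UC]] := kernel_frame hC (mpk s).
  exists (d s), (T s), (mu s), (Y s), (fun w => U^T *m Y s w *m U).
  split; [exact: hY|exact: std_gaussian_compression|].
  apply: aeW => w; apply: transition_stat_le_pos_eig => //.
    exact: std_gaussian_sym (hY s).
  by case: hC => -[].
- exact: law_top.
- move=> alpha a01 q_alpha s.
  have crit (C : 'M[R]_(q - s)) : rank_cone R (r - s) (q - s) C ->
      (mu s [set w | (q_alpha < transition_stat (r - s) C (Y s w))%R]
         <= alpha%:E)%E.
    move=> hC; have [U [U1 UC]] := kernel_frame hC (mpk s).
    have gG := std_gaussian_compression U1 (hY s).
    have lawG := law_top _ _ _ _ gG.
    have [mG mDelta _] := lawG.
    apply: le_trans (upper_crit_tail (mu ord_max) mDelta a01).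
    rewrite -(same_law_gt _ lawG); apply: le_measure.
    + rewrite inE.
      have := transition_stat_measurable (r - s) C (hY s).
      move=> /(_ measurableT `]q_alpha, +oo[%classic (measurable_itv _)).
      rewrite setTI; congr measurable.
      by apply/seteqP; split=> w; rewrite /= in_itv/= andbT.
    + rewrite inE.
      have := mG measurableT `]q_alpha, +oo[%classic (measurable_itv _).
      rewrite setTI; congr measurable.
      by apply/seteqP; split=> w; rewrite /= in_itv/= andbT.
    + move=> w /= /lt_le_trans; apply; apply: transition_stat_le_pos_eig => //.
        exact: std_gaussian_sym (hY s).
      by case: hC => -[].
  (* in the isotropic case the fixed stratum is the transition with C = 0 *)
  split; last exact: crit.
  rewrite (_ : Delta s = fun w => transition_stat (r - s) 0 (Y s w)).
    exact/crit/rank_cone0.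
  by apply/funext => w; exact: DeltaE.
Qed.
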